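(* Fix $\alpha\in(-1,1)$ and $N\in\mathbb{N}$. Let $a$ be a nonnegative parameter and let $\tilde a\ge 2$ be a positive integer. The operator matrices $D_\varphi^{(a)}$, $W_\varphi^{(a)}$, $D_\theta$, $\mathcal{L}^{(a)\to(a+\tilde a)}$, $\mathcal{L}_W^{(a)\to(a-\tilde a)}$ (defined for $a\ge2$ only) and $\Delta_W^{(1)}$ (the case $a=1$ only), as defined in the context, are sparse, with banded-block-banded structure. More specifically, with respect to the partition of the rows and columns into blocks indexed by the Fourier mode $k=0,\dots,N$: \begin{itemize} \item $D_\varphi^{(a)}$ is block-diagonal with sub-block-bandwidths $(2,4)$; \item $W_\varphi^{(a)}$ is block-diagonal with sub-block-bandwidths $(4,2)$; \item $D_\theta$ is block-diagonal with sub-block-bandwidths $(1,1)$; \item $\mathcal{L}^{(a)\to(a+\tilde a)}$ is block-diagonal with sub-block-bandwidths $(0,4)$; \item $\mathcal{L}_W^{(a)\to(a-\tilde a)}$ is block-diagonal with sub-block-bandwidths $(4,0)$; \item $\Delta_W^{(1)}$ is block-diagonal with sub-block-bandwidths $(2,2)$. \end{itemize}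
   Context: **Domain.** $\Omega=\{(x,y,z)\in\mathbb{R}^3: \alpha<z<1,\ x^2+y^2+z^2=1\}$, with $\rho(z)=\sqrt{1-z^2}$ and spherical coordinates $z=\cos\varphi$, $x=\sin\varphi\cos\theta=\rho(z)\cos\theta$, $y=\sin\varphi\sin\theta=\rho(z)\sin\theta$. The spherical Laplacian is $\Delta_S=\frac1\rho\frac{\partial}{\partial\varphi}\big(\rho\frac{\partial}{\partial\varphi}\big)+\frac1{\rho^2}\frac{\partial^2}{\partial\theta^2}$, where $\rho=\sin\varphi$. **Univariate polynomials.** For parameters $a,b$ let $w_R^{(a,b)}(z)=(z-\alpha)^a\rho(z)^b$ on $(\alpha,1)$ and $\omega_R^{(a,b)}=\int_\alpha^1 w_R^{(a,b)}(z)\,dz$. Let $R_n^{(a,b)}$ ($n=0,1,2,\dots$) be the polynomials of degree $n$ that are orthonormal for $\langle p,q\rangle_{w_R^{(a,b)}}=\frac{1}{\omega_R^{(a,b)}}\int_\alpha^1 p\,q\,w_R^{(a,b)}\,dz$. **Circular harmonics.** $Y_{0,0}(\theta)=\frac{\sqrt2}{2}$, and $Y_{k,0}(\theta)=\cos k\theta$, $Y_{k,1}(\theta)=\sin k\theta$ for $k\ge1$. **Orthogonal polynomials on the cap.** For $0\le k\le n$, with $i\in\{0,1\}$ if $k\ge1$ and $i=0$ if $k=0$, $Q^{(a)}_{n,k,i}(x,y,z)=R^{(a,2k)}_{n-k}(z)\,\rho(z)^k\,Y_{k,i}(\theta)$. For fixed $a$ these are polynomials in $(x,y,z)$ of degree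 $n$, orthogonal with respect to $\int_\Omega p\,q\,(z-\alpha)^a\,dA$, where $dA$ is the uniform spherical measure. **Ordering.** Let $\tilde{\mathbb Q}_N^{(a)}$ be the column vector of all $Q^{(a)}_{n,k,i}$ with $0\le k\le n\le N$, grouped into blocks by $k=0,1,\dots,N$. Block $k=0$ is ordered as $(n,k,i)=(0,0,0),(1,0,0),\dots,(N,0,0)$; block $k\ge1$ is ordered as $(k,k,0),(k,k,1),(k+1,k,0),(k+1,k,1),\dots,(N,k,0),(N,k,1)$. Let $\mathbb W_N^{(a)}=w_R^{(a,0)}(z)\,\tilde{\mathbb Q}_N^{(a)}$. **Operator matrices.** A function $f$ on $\Omega$ is represented by its coefficient vector $\mathbf f$ through the expansion up to degree $N$, $f=(\tilde{\mathbb Q}_N^{(a)})^\top\mathbf f$. The matrices act on coefficient vectors and are defined by - $\rho\,\frac{\partial f}{\partial\varphi}=(\tilde{\mathbb Q}_N^{(a+1)})^\top D_\varphi^{(a)}\,\mathbf f$, - $\rho\,\frac{\partial}{\partial\varphi}\big[w_R^{(a,0)}(z)\,f\big]=(\mathbb W_N^{(a-1)})^\top W_\varphi^{(a)}\,\mathbf f$, - $\frac{\partial f}{\partial\theta}=(\tilde{\mathbb Q}_N^{(a)})^\top D_\theta\,\mathbf f$, - $\Delta_S f=(\tilde{\mathbb Q}_N^{(a+\tilde a)})^\top\mathcal{L}^{(a)\to(a+\tilde a)}\,\mathbf f$, - $\Delta_S\big(w_R^{(a,0)}(z)\,f\big)=(\mathbb W_N^{(a-\tilde a)})^\top\mathcal{L}_W^{(a)\to(a-\tilde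 a)}\,\mathbf f$ (for $a\ge2$ only), - $\Delta_S\big(w_R^{(1,0)}(z)\,f\big)=(\tilde{\mathbb Q}_N^{(1)})^\top\Delta_W^{(1)}\,\mathbf f$ (for $a=1$ only). That is, the column of each matrix indexed by $(n,k,i)$ contains the coefficients, in the stated target basis, of the image of the corresponding basis function (terms of degree above $N$ being dropped). **Bandwidths.** A matrix $B=(B_{p,q})$ has bandwidths $(\lambda,\mu)$ if $B_{p,q}=0$ unless $-\lambda\le q-p\le\mu$. A block matrix with blocks $A_{i,j}$ has block-bandwidths $(L,U)$ if $A_{i,j}=0$ unless $-L\le j-i\le U$ (block-diagonal means block-bandwidths $(0,0)$), and sub-block-bandwidths $(\lambda,\mu)$ if all blocks are banded with bandwidths $(\lambda,\mu)$. A matrix whose block-bandwidths and sub-block-bandwidths are small compared to its dimensions is called banded-block-banded.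
   Formalization: The sub-block-bandwidths (0,4) of L^{(a)→(a+ã)} and (4,0) of L_W^{(a)→(a-ã)} fail for ã≥3 (e.g. α=0, a=0 resp. a=3, ã=3, N=4); they are proved as (0,2ã) and (2ã,0), which agree with the printed values at ã=2. *)

(* Defs.v *)
From mathcomp Require Import all_boot all_order all_algebra.
From mathcomp Require Import all_classical all_reals all_analysis.

Set Implicit Arguments.
Unset Strict Implicit.
Unset Printing Implicit Defensive.

Import Order.TTheory GRing.Theory Num.Theory.
Import numFieldNormedType.Exports.

Local Open Scope classical_set_scope.
Local Open Scope ring_scope.

Section UnivariatePolynomials.
Context {R : realType}.

Definition rho (z : R) : R := Num.sqrt (1 - z ^+ 2).

Definition wR (alpha a b z : R) : R := (z - alpha) `^ a * rho z `^ b.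

Definition omegaR (alpha a b : R) : R :=
  \int[lebesgue_measure]_(z in `]alpha, 1[) wR alpha a b z.

Definition inner_wR (alpha a b : R) (p q : {poly R}) : R :=
  (omegaR alpha a b)^-1 *
  \int[lebesgue_measure]_(z in `]alpha, 1[) (p.[z] * q.[z] * wR alpha a b z).

Definition orthonormal_polys (alpha a b : R) (P : nat -> {poly R}) : Prop :=
  (forall n, size (P n) = n.+1) /\
  (forall m n, inner_wR alpha a b (P m) (P n) = (m == n)%:R).

End UnivariatePolynomials.

(* Functions on the cap, in the spherical coordinates (phi, theta). *)
Definition cap_fun (R : realType) := R -> R -> R.

(* Families indexed by (n, k, i); only the indices with k <= n and
   i < (0 < k).+1 (that is, i = 0 if k = 0, and i = 0, 1 otherwise) matter. *)
Definition basis (R : realType) := nat -> nat -> nat -> cap_fun R.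

Section Cap.
Context {R : realType}.

(* The pole z = 1 and the boundary circle z = alpha are not in the cap, so phi
   ranges over the open interval where alpha < cos phi < 1; theta is
   unrestricted, all functions of interest being 2 pi-periodic in it. *)
Definition cap_phi (alpha phi : R) : bool :=
  [&& 0 < phi, phi < pi & alpha < cos phi].

Definition partial_phi (f : cap_fun R) : cap_fun R :=
  fun phi theta => derive1 (fun s : R => f s theta) phi.

Definition partial_theta (f : cap_fun R) : cap_fun R :=
  fun phi theta => derive1 (f phi) theta.

Definition rho_partial_phi (f : cap_fun R) : cap_fun R :=
  fun phi theta => sin phi * partial_phi f phi theta.

Definition laplaceS (f : cap_fun R) : cap_fun R :=
  fun phi theta =>
    (sin phi)^-1 * partial_phi (rho_partial_phi f) phi theta +
    (sin phi ^+ 2)^-1 * partial_theta (partial_theta f) phi theta.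

Definition wmul (alpha a : R) (f : cap_fun R) : cap_fun R :=
  fun phi theta => wR alpha a 0 (cos phi) * f phi theta.

Definition Y (k i : nat) (theta : R) : R :=
  if k == 0%N then Num.sqrt 2 / 2
  else if i == 0%N then cos (k%:R * theta) else sin (k%:R * theta).

(* Rp a b n is the degree-n polynomial R_n^(a,b). *)
Definition Q (Rp : R -> R -> nat -> {poly R}) (a : R) : basis R :=
  fun n k i phi theta =>
    (Rp a (2 * k)%N%:R (n - k)%N).[cos phi] * rho (cos phi) ^+ k * Y k i theta.

Definition weighted (alpha a : R) (B : basis R) : basis R :=
  fun n k i => wmul alpha a (B n k i).

End Cap.

Section Ordering.
Local Open Scope nat_scope.

Definition block_size (N : nat) (k : 'I_N.+1) : nat :=
  if k == 0 :> nat then N.+1 else (N - k).+1.*2.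

(* Degree n and index i of the p-th entry of block k. *)
Definition entry_deg (k p : nat) : nat := if k == 0 then p else k + p./2.

Definition entry_par (k p : nat) : nat := if k == 0 then 0 else odd p.

Definition Qtilde {R : realType} (N : nat) (B : basis R) (phi theta : R) :
    'cV[R]_(\sum_(k < N.+1) block_size k) :=
  (\mxcol_(k < N.+1) \col_(p < block_size k)
      B (entry_deg k p) k (entry_par k p) phi theta)%R.

Definition expansion {R : realType} (N : nat) (B : basis R)
    (f : 'cV[R]_(\sum_(k < N.+1) block_size k)) : cap_fun R :=
  fun phi theta => ((Qtilde N B phi theta)^T *m f)%R 0%R 0%R.

End Ordering.

Section OperatorMatrices.
Context {R : realType}.

Definition high_degree (alpha : R) (N : nat) (B : basis R)
    (r : cap_fun R) : Prop :=
  exists (M : nat) (c : nat -> nat -> nat -> R),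
    forall phi theta, cap_phi alpha phi ->
      r phi theta = \sum_(N.+1 <= n < M) \sum_(k < n.+1) \sum_(i < (0 < k)%N.+1)
                      c n k i * B n k i phi theta.

(* A maps the coefficients of f in src to those of T f in tgt; r collects the
   terms of degree above N of T f, which are dropped. *)
Definition operator_matrix (alpha : R) (N : nat) (T : cap_fun R -> cap_fun R)
    (src tgt : basis R) (A : 'M[R]_(\sum_(k < N.+1) block_size k)) : Prop :=
  forall f : 'cV[R]_(\sum_(k < N.+1) block_size k),
    exists r : cap_fun R, high_degree alpha N tgt r /\
      forall phi theta, cap_phi alpha phi ->
        T (expansion src f) phi theta =
        expansion tgt (A *m f) phi theta + r phi theta.

End OperatorMatrices.

Section Bandwidths.
Context {R : realType}.

(* - l <= q - p <= u, written without subtraction. *)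
Definition in_band (l u p q : nat) : bool := (p <= q + l)%N && (q <= p + u)%N.

Definition bandwidths (m n : nat) (B : 'M[R]_(m, n)) (l u : nat) : Prop :=
  forall (p : 'I_m) (q : 'I_n), ~~ in_band l u p q -> B p q = 0.

Definition block_bandwidths (N : nat)
    (A : 'M[R]_(\sum_(k < N.+1) block_size k)) (L U : nat) : Prop :=
  forall i j : 'I_N.+1, ~~ in_band L U i j -> submxblock A i j = 0.

Definition block_diagonal (N : nat)
    (A : 'M[R]_(\sum_(k < N.+1) block_size k)) : Prop :=
  block_bandwidths A 0 0.

Definition sub_block_bandwidths (N : nat)
    (A : 'M[R]_(\sum_(k < N.+1) block_size k)) (l u : nat) : Prop :=
  forall i j : 'I_N.+1, bandwidths (submxblock A i j) l u.

End Bandwidths.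

(* Main.v *)
(* On the cap, with z = cos phi, every function involved is a combination of
   (z - alpha)^s p(z) rho^k Y_k(theta) with p a polynomial. The operators preserve the
   mode k, which gives the block-diagonal structure, and act on p by an explicit
   differential operator; its effect on the degree of p bounds the lower sub-block
   bandwidth. The upper one comes by duality: moving the operator onto a test polynomial
   g by integrating the derivative of (z - alpha)^s (1 - z^2)^(k+1) G, whose boundary
   terms vanish, turns <L R_n, g> into <R_n, h> with deg h <= deg g + u, which is zero
   when deg g + u < n. A step in degree is a step of two inside a block with k >= 1,
   where the cosine and sine entries alternate. *)
Require Import Defs.
From mathcomp Require Import all_boot all_order all_algebra.
From mathcomp Require Import all_classical all_reals all_analysis.
From mathcomp Require Import measurable_realfun.
From mathcomp Require Import ring lra zify.

Set Implicit Arguments.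
Unset Strict Implicit.
Unset Printing Implicit Defensive.

Import Order.TTheory GRing.Theory Num.Theory.
Import numFieldNormedType.Exports.

Local Open Scope ring_scope.

(** * Expansions in orthonormal polynomials *)

(** The constants obey one count. On polynomials, [rho d/dphi] costs one degree and the Laplacian
    none, whichever side of the pairing it acts on. But [<R_n, h>] vanishes for low degree only in
    the source weight [(z - alpha)^a], so every surplus factor [z - alpha] left by the target weight
    must be charged to [h], one degree each. This gives [u = 1+1, 1+0, 0+ta, 0, 0+1] for [D_phi],
    [W_phi], [L], [L_W], [Delta_W]. Dually, the factors not absorbed by the weight in front of the
    image give [l = 1+0, 1+1, 0, 0+ta, 0+1]. Hence the Laplacian bands depend on [ta], with
    [2 * ta = 4] at [ta = 2].

    Two obstacles remain. Exponents in [(-1, 0)] make the integrands singular at [alpha], so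
    integration by parts is improper there. And since the dropped terms may have any degree above
    [N], uniqueness of a matrix needs linear independence of the target family in all degrees. *)

Section OrthonormalPolynomials.
Context {K : fieldType} (J : {poly K} -> K) (P : nat -> {poly K}).
Hypothesis J_linear : forall c p q, J (c *: p + q) = c * J p + J q.
Hypothesis size_P : forall n, size (P n) = n.+1.

Let J0 : J 0 = 0.
Proof. by have := J_linear (-1) 0 0; rewrite scaler0 addr0 mulN1r addNr. Qed.

Lemma linear_form_sum (I : Type) (r : seq I) (Q : pred I) (F : I -> {poly K}) (c : I -> K) :
  J (\sum_(i <- r | Q i) c i *: F i) = \sum_(i <- r | Q i) c i * J (F i).
Proof.
elim: r => [|i r IH]; first by rewrite !big_nil.
by rewrite !big_cons; case: ifP => _; rewrite ?J_linear IH.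
Qed.

Lemma graded_span n (q : {poly K}) : (size q <= n)%N ->
  exists c : nat -> K, q = \sum_(j < n) c j *: P j.
Proof.
elim: n q => [|n IH] q.
  by rewrite leqn0 size_poly_eq0 => /eqP ->; exists (fun=> 0); rewrite big_ord0.
move=> sq; have lP : lead_coef (P n) != 0.
  by rewrite lead_coef_eq0 -size_poly_gt0 size_P.
pose d := q`_n / lead_coef (P n).
have /IH[c qc] : (size (q - d *: P n)%R <= n)%N.
  apply/leq_sizeP => j; rewrite leq_eqVlt => /predU1P[<-|nj].
    rewrite coefB coefZ /d; move: lP; rewrite lead_coefE size_P /= => lP.
    by rewrite divfK ?subrr.
  rewrite coefB coefZ !nth_default ?mulr0 ?subr0 ?size_P //.
  exact: leq_trans sq nj.
exists (fun j => if j == n then d else c j).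
rewrite big_ord_recr /= eqxx -[LHS](subrK (d *: P n)) qc; congr (_ + _).
by apply: eq_bigr => i _; rewrite ltn_eqF.
Qed.

Hypothesis orthoP : forall m n, J (P m * P n) = (m == n)%:R.

Lemma orthonormal_low_degree n (q : {poly K}) : (size q <= n)%N -> J (P n * q) = 0.
Proof.
move=> /graded_span[c ->]; rewrite mulr_sumr.
under eq_bigr do rewrite -scalerAr.
by rewrite linear_form_sum big1 // => i _; rewrite orthoP gtn_eqF ?mulr0.
Qed.

Lemma orthonormal_expansion n (q : {poly K}) : (size q <= n)%N ->
  q = \sum_(j < n) J (q * P j) *: P j.
Proof.
move=> /graded_span[c qc]; rewrite {1}qc; apply: eq_bigr => j _; congr (_ *: _).
rewrite qc mulr_suml; under eq_bigr do rewrite -scalerAl.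
rewrite linear_form_sum (bigD1 j) //= orthoP eqxx mulr1 big1 ?addr0 // => i ij.
by rewrite orthoP -val_eqE in ij *; rewrite (negbTE ij) mulr0.
Qed.

End OrthonormalPolynomials.

(** * Weighted integrals on (alpha, 1) *)

Section WeightedIntegrals.
Local Open Scope classical_set_scope.
Local Open Scope ring_scope.
Context {R : realType} (al : R).
Hypothesis al1 : -1 < al < 1.
Local Notation mu := (@lebesgue_measure R).

(** This is [wR] with second parameter [2 * k] on []al, 1[]: the even power of [rho] becomes a
    polynomial, and only [z - al] keeps a real exponent. *)
Definition weight (b : R) (k : nat) (z : R) : R := (z - al) `^ b * (1 - z ^+ 2) ^+ k.

Definition wint (b : R) (k : nat) (p : {poly R}) : R :=
  \int[mu]_(z in `]al, 1[) (p.[z] * weight b k z).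

Lemma itv_one_sqr_ge0 (z : R) : al <= z -> z <= 1 -> 0 <= 1 - z ^+ 2.
Proof. by case/andP: al1 => *; nra. Qed.

Lemma wRE b k z : z \in `]al, 1[ -> wR al b (2 * k)%N%:R z = weight b k z.
Proof.
rewrite in_itv /= => /andP[az z1]; rewrite /wR /weight /rho.
by rewrite powR_mulrn ?sqrtr_ge0 // exprM sqr_sqrtr // itv_one_sqr_ge0 ?ltW.
Qed.

Lemma weight_ge0 b k z : z \in `[al, 1] -> 0 <= weight b k z.
Proof.
rewrite in_itv /= => /andP[az z1].
by rewrite /weight mulr_ge0 ?powR_ge0 // exprn_ge0 // itv_one_sqr_ge0.
Qed.

Lemma measurable_horner (D : set R) (p : {poly R}) :
  measurable_fun D (horner p : R -> R).
Proof.
by apply: measurable_funTS; apply: continuous_measurable_fun => x; exact: continuous_horner.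
Qed.

Lemma measurable_weight (D : set R) b k : measurable_fun D (weight b k).
Proof.
apply: measurable_funM.
  by apply: (measurableT_comp (measurable_powR b)); exact: measurable_funB.
by apply: measurable_funX; apply: measurable_funB => //; exact: measurable_funX.
Qed.

Lemma integrable_horner_weight b k p :
  mu.-integrable `[al, 1] (EFin \o weight b k) ->
  mu.-integrable `[al, 1] (EFin \o (fun z => p.[z] * weight b k z)).
Proof.
move=> iw.
rewrite (_ : _ \o _ = ((EFin \o horner p) \* (EFin \o weight b k))%E); last first.
  by apply/funext => z /=; rewrite EFinM.
apply: integrableMr => //; first exact: measurable_horner.
have [M pM] := poly_itv_bound p al 1.
exists M; split=> [|x Mx z]; first by rewrite num_real.
by rewrite /= in_itv /= => /pM /le_trans -> //; exact: ltW.
Qed.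

(* The real-valued integral of a nonnegative non-integrable function is [fine +oo = 0],
   so the normalization [<P_0, P_0> = 1] forces the weight to be integrable. *)
Lemma orthonormal_integrable b k P : orthonormal_polys al b (2 * k)%N%:R P ->
  mu.-integrable `[al, 1] (EFin \o weight b k).
Proof.
move=> [_ /(_ 0 0)%N]; rewrite /inner_wR /= => oP.
have mw D : measurable_fun D (EFin \o weight b k).
  by apply/measurable_EFinP; exact: measurable_weight.
apply/integrableP; split; first exact: mw.
have: omegaR al b (2 * k)%N%:R != 0.
  by apply: contra_eq_neq oP => ->; rewrite invr0 mul0r eq_sym oner_eq0.
rewrite /omegaR (@eq_Rintegral _ _ _ mu _ (weight b k)); last first.
  by move=> z; rewrite inE /= => /wRE ->.
under eq_integral.
  move=> z; rewrite inE /= => zi; rewrite ger0_norm ?weight_ge0 //; over.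
rewrite /= (@integral_itv_bndoo _ al 1 (EFin \o weight b k) true false) //.
rewrite /Rintegral /=.
case: (integral _ _ _)
  (@integral_ge0 _ _ _ mu `]al, 1[ (EFin \o weight b k)) => [r _ _| |] //=.
- by rewrite ltry.
- by rewrite eqxx.
Qed.


Lemma wint_linear b k c (p q : {poly R}) :
  mu.-integrable `[al, 1] (EFin \o weight b k) ->
  wint b k (c *: p + q) = c * wint b k p + wint b k q.
Proof.
move=> iw; have ip r : mu.-integrable `]al, 1[ (EFin \o (fun z => r.[z] * weight b k z)).
  by apply: integrableS (integrable_horner_weight r iw) => //; exact: subset_itv_oo_cc.
rewrite /wint -RintegralZl // -RintegralD //; last first.
  rewrite (_ : EFin \o _ = EFin \o (fun z => (c *: p).[z] * weight b k z)) //.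
  by apply/funext => z /=; rewrite hornerZ mulrA.
by apply: eq_Rintegral => z _ /=; rewrite hornerD hornerZ; ring.
Qed.

Lemma wint_shift b m k (p : {poly R}) :
  wint (b + m%:R) k p = wint b k (('X - al%:P) ^+ m * p).
Proof.
apply: eq_Rintegral => z; rewrite inE /= in_itv /= => /andP[az _].
rewrite /weight powRD; last by rewrite subr_eq0 (gt_eqF az) implybT.
by rewrite powR_mulrn ?subr_ge0 ?ltW // hornerM horner_exp hornerXsubC; ring.
Qed.

Lemma is_derive_powR_shift s z : al < z ->
  is_derive z 1 (fun y => (y - al) `^ s) (s * (z - al) `^ (s - 1)).
Proof.
rewrite -subr_gt0 => za0; rewrite -(mulr1 (s * _)).
have d1 : is_derive z 1 (fun y => y - al) 1 by apply: is_derive_eq; rewrite subr0.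
have := @is_derive1_comp R (fun y => y `^ s) (fun y => y - al) z _ _ (is_derive1_powR s za0) d1.
exact.
Qed.

Lemma powR_subr1 s z : al < z -> (z - al) `^ s = (z - al) `^ (s - 1) * (z - al).
Proof.
rewrite -subr_gt0 => za0; rewrite -[X in _ = _ * X]powRr1 ?ltW // -powRD ?subrK //.
by rewrite (gt_eqF za0) implybT.
Qed.

Lemma is_derive_powR_horner s (H : {poly R}) z : al < z ->
  is_derive z 1 (fun y => (y - al) `^ s * H.[y])
    ((z - al) `^ (s - 1) * (s *: H + ('X - al%:P) * H^`()).[z]).
Proof.
move=> az; apply: is_derive_eq.
  exact: is_deriveM (is_derive_powR_shift s az) (is_derive_poly H z).
by rewrite /= (powR_subr1 s az) !hornerE /GRing.scale /=; ring.
Qed.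

(** [f] is the derivative of [(z - al)^s H], which vanishes at 1 and tends to 0 at [al]. Since [f]
    may blow up at [al] when [s < 1], the fundamental theorem is applied on [[x, 1]] only, and then
    [x] tends to [al]. *)
Lemma powR_horner_integral0 s (H : {poly R}) : 0 < s -> H.[1] = 0 ->
  let f z := (z - al) `^ (s - 1) * (s *: H + ('X - al%:P) * H^`()).[z] in
  mu.-integrable `[al, 1] (EFin \o f) -> \int[mu]_(z in `]al, 1[) f z = 0.
Proof.
move=> s0 H1 f fi; have [_ lt_al1] := andP al1.
pose F z := (z - al) `^ s * H.[z].
have dF z : al < z -> is_derive z 1 F (f z) by exact: is_derive_powR_horner.
have cf z : al < z -> {for z, continuous f}.
  move=> az; have cw : {for z, continuous (fun y => (y - al) `^ (s - 1))}.
    apply: differentiable_continuous; apply/derivable1_diffP.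
    by have [] := is_derive_powR_shift (s - 1) az.
  by apply: cvgM; [exact: cw|exact: continuous_horner].
have fi' : mu.-integrable `]al, 1[ (EFin \o f).
  by apply: integrableS fi => //; exact: subset_itv_oo_cc.
have fi'' : mu.-integrable `[al, 1[ (EFin \o f).
  by apply: integrableS fi => //; exact: subset_itv_co_cc.
rewrite Rintegral_itv_obnd_cbnd // Rintegral_itv_bndo_bndc //.
(* The difference does not depend on [x], while both of its terms tend to 0 at [al]: the first by
   integrability, the second because [0 < s]. *)
have key : \forall x \near al^'+,
    parameterized_integral mu al x f - F x = \int[mu]_(z in `[al, 1]) f z.
  near=> x.
  have ax : al < x by near: x; exact: nbhs_right_gt.
  have x1 : x < 1 by near: x; exact: nbhs_right_lt.
  have xb : (BLeft al <= BRight x)%O by rewrite bnd_simp ltW.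
  have bx : (BRight x <= BRight 1)%O by rewrite bnd_simp ltW.
  apply/eqP; rewrite eq_sym addrC -subr_eq; apply/eqP.
  rewrite /parameterized_integral (Rintegral_itvB fi xb bx).
  have fx : mu.-integrable `]x, 1] (EFin \o f).
    by apply: integrableS fi => //; apply: subset_itvScc; rewrite bnd_simp // ltW.
  rewrite Rintegral_itv_obnd_cbnd // /Rintegral (@continuous_FTC2 _ _ F) //=.
  - by rewrite {1}/F H1 mulr0 sub0r.
  - apply: continuous_in_subspaceT => y; rewrite inE /= in_itv /= => /andP[xy _].
    by apply: cf; exact: lt_le_trans xy.
  - have cF y : al < y -> {for y, continuous F}.
      by move=> /dF[dFy _]; apply: differentiable_continuous; exact/derivable1_diffP.
    split.
    + by move=> y; rewrite in_itv /= => /andP[xy _]; have [] := dF _ (lt_trans ax xy).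
    + exact/cvg_at_right_filter/cF.
    + exact/cvg_at_left_filter/cF.
  - move=> y; rewrite in_itv /= => /andP[xy _]; rewrite derive1E.
    by have [] := dF _ (lt_trans ax xy).
have lim0 : parameterized_integral mu al x f - F x @[x --> al^'+] --> (0 - 0 : R).
  apply: cvgB.
    exact: cvg_at_right_filter (parameterized_integral_cvg_left lt_al1 fi).
  rewrite -(mul0r H.[al]); apply: cvgM; last first.
    by apply: cvg_at_right_filter; exact: continuous_horner.
  have := @increasing_cvg_at_right_comp R (fun x => x - al) (fun x => x `^ s) al +oo%O 0.
  apply=> //.
  - by move=> u v _ _ uv; rewrite ltrD2r.
  - by apply: cvg_at_right_filter; apply: cvgB; [exact: cvg_id|exact: cvg_cst].
  - by rewrite subrr; exact: powR_cvg0.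
rewrite subrr in lim0.
apply: (@norm_cvg_unique _ _ (_ @ al^'+)) lim0.
have ykey : {near al^'+, (fun=> \int[mu]_(z in `[al, 1]) f z) =1
    (fun x => parameterized_integral mu al x f - F x)}.
  by apply: filterS key.
by apply: cvg_trans (near_eq_cvg ykey) _; exact: cvg_cst.
Unshelve. all: by end_near. Qed.

End WeightedIntegrals.

(** * The differential operators on polynomials *)

Section PolynomialOperators.
Context {R : comNzRingType} (al : R).
Implicit Types (s : R) (k : nat) (p g : {poly R}).

Local Notation Xa := ('X - al%:P).

(* [((1 - z^2)^(k+1) V)' = (1 - z^2)^k dvg k V] *)
Definition dvg k (V : {poly R}) : {poly R} :=
  (1 - 'X ^+ 2) * V^`() - (2 * k.+1)%:R * 'X * V.

(* [((z - al)^s (1 - z^2)^(k+1) G)' = (z - al)^(s-1) (1 - z^2)^k pearson s k G] *)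
Definition pearson s k (G : {poly R}) : {poly R} :=
  s%:P * (1 - 'X ^+ 2) * G + Xa * dvg k G.

(* [rho d/dphi] maps [(z - al)^s p rho^k] to [(z - al)^(s-1) (dphi s k p) rho^k]. *)
Definition dphi s k p : {poly R} :=
  - (1 - 'X ^+ 2) * (s%:P * p + Xa * p^`()) + k%:R * 'X * Xa * p.

(* The spherical Laplacian maps [(z - al)^s p rho^k Y_k] to
   [(z - al)^(s-2) (lap s k p) rho^k Y_k]. *)
Definition lap s k p : {poly R} :=
  pearson (s - 1) k (s%:P * p + Xa * p^`()) - (k * k.+1)%:R * Xa ^+ 2 * p.

Lemma deriv_nat n : (n%:R : {poly R})^`() = 0.
Proof. by rewrite -(rmorph_nat (@polyC R)) derivC. Qed.

Ltac polyring :=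
  rewrite /lap /dphi /pearson /dvg ?polyCD ?polyCB ?polyCN ?polyC1;
  rewrite ?(poly.derivE, deriv_nat, deriv_nat 1) /=; ring.

(** The left side has the shape [s H + (z - al) H'] required by [powR_horner_integral0], for
    [H = (1 - z^2)^(k+1) G]. *)
Lemma pearsonE s k G :
  s%:P * ((1 - 'X ^+ 2) ^+ k.+1 * G) + Xa * ((1 - 'X ^+ 2) ^+ k.+1 * G)^`() =
  (1 - 'X ^+ 2) ^+ k * pearson s k G.
Proof. by rewrite derivM deriv_exp exprS /=; polyring. Qed.

(** The Laplacian is [rho^-2] times [(rho d/dphi)^2 + d^2/dtheta^2], and [Y k i] has eigenvalue
    [-k^2] for the latter. Divisibility by [1 - z^2] is what keeps the Laplacian within
    polynomials. *)
Lemma dphi_dphi s k p :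
  dphi (s - 1) k (dphi s k p) - (k ^ 2)%:R * Xa ^+ 2 * p = (1 - 'X ^+ 2) * lap s k p.
Proof. by polyring. Qed.

(** For [s = 0], and for [lap] at [s = 1], the factors [z - al] split off here exactly cancel the
    negative powers that differentiation introduces, so the image is again unweighted. *)
Lemma dphi0 k p : dphi 0 k p = Xa * (- (1 - 'X ^+ 2) * p^`() + k%:R * 'X * p).
Proof. by polyring. Qed.

Lemma lap0 k p : lap 0 k p = Xa ^+ 2 * (dvg k p^`() - (k * k.+1)%:R * p).
Proof. by polyring. Qed.

Lemma lap1 k p :
  lap 1 k p = Xa * (dvg k (p + Xa * p^`()) - (k * k.+1)%:R * Xa * p).
Proof. by polyring. Qed.

(** In each identity of this kind the [pearson] terms with factor [p] or its derivative integrate to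
    0, and what is left is [p] times an operator applied to [g] alone. *)
Lemma dphi0_by_parts s k p g :
  Xa * ((- (1 - 'X ^+ 2) * p^`() + k%:R * 'X * p) * g) =
  - pearson s k (p * g) + p * (pearson s k g + k%:R * 'X * Xa * g).
Proof. by polyring. Qed.

Lemma dphi_by_parts s k p g :
  dphi s k p * g = - pearson s k (p * g) + Xa * (p * (dvg k g + k%:R * 'X * g)).
Proof. by polyring. Qed.

(** Two integrations by parts; [(z - al)^(s-1) G] is the derivative of [(z - al)^s g]. *)
Lemma lap0_by_parts s k p g :
  let G := Xa * g^`() + s%:P * g in
  Xa ^+ 2 * ((dvg k p^`() - (k * k.+1)%:R * p) * g) =
  Xa * pearson s k (p^`() * g) - pearson (s - 1) k (p * G)
  + p * (pearson (s - 1) k G - (k * k.+1)%:R * Xa ^+ 2 * g).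
Proof. by polyring. Qed.

Lemma lap_by_parts s k p g :
  lap s k p * g =
  pearson (s - 1) k ((s%:P * p + Xa * p^`()) * g) - Xa * pearson s k (p * g^`())
  + Xa ^+ 2 * (p * (dvg k g^`() - (k * k.+1)%:R * g)).
Proof. by polyring. Qed.

(** Green's identity for the Gegenbauer-type operator [V -> dvg k V' - k(k+1) V], symmetric for
    [(1 - z^2)^k], applied to [(z - al) p] and [(z - al) g]. *)
Lemma lap1_by_parts k p g :
  let G := Xa * g in
  (dvg k (p + Xa * p^`()) - (k * k.+1)%:R * Xa * p) * G =
  pearson 1 k ((p + Xa * p^`()) * g) - pearson 1 k (p * G^`())
  + Xa * (p * (dvg k G^`() - (k * k.+1)%:R * G)).
Proof. by polyring. Qed.

End PolynomialOperators.

(** * Effect of the operators on degrees *)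

Section SizeBounds.
Context {R : comNzRingType} (al : R).
Implicit Types (s : R) (k : nat) (p q : {poly R}).

Local Notation Xa := ('X - al%:P).

(** A degree bound on one factor and a size bound on the other: no predecessor appears, and zero
    polynomials need no side condition. *)
Lemma size_mul_bound m n p q :
  (size p <= m.+1)%N -> (size q <= n)%N -> (size (p * q)%R <= m + n)%N.
Proof.
move=> sp sq; have [->|q0] := eqVneq q 0; first by rewrite mulr0 size_poly0.
apply: leq_trans (size_polyMleq _ _) _.
by move: q0; rewrite -size_poly_gt0; lia.
Qed.

Lemma size_add_bound n p q :
  (size p <= n)%N -> (size q <= n)%N -> (size (p + q)%R <= n)%N.
Proof. by move=> sp sq; rewrite (leq_trans (size_polyD _ _)) // geq_max sp. Qed.

Lemma size_sub_bound n p q :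
  (size p <= n)%N -> (size q <= n)%N -> (size (p - q)%R <= n)%N.
Proof. by move=> sp sq; rewrite size_add_bound // size_polyN. Qed.

Lemma size_deriv_bound n p : (size p <= n.+1)%N -> (size p^`() <= n)%N.
Proof.
move=> sp; have [->|p0] := eqVneq p 0; first by rewrite deriv0 size_poly0.
by rewrite -ltnS (leq_trans (lt_size_deriv p0)).
Qed.

Lemma size_nat_bound n : (size (n%:R : {poly R}) <= 1)%N.
Proof. by rewrite -(rmorph_nat (@polyC R)) size_polyC_leq1. Qed.

Lemma size_Xa_exp m : (size (Xa ^+ m)%R <= m.+1)%N.
Proof. by rewrite size_exp_XsubC. Qed.

Lemma size_rho2 : (size (1 - 'X ^+ 2 : {poly R})%R <= 3)%N.
Proof. by rewrite size_sub_bound ?size_polyXn // (leq_trans (size_nat_bound 1)). Qed.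

Lemma size_natX n : (size (n%:R * 'X : {poly R})%R <= 2)%N.
Proof. by rewrite (@size_mul_bound 0 2) ?size_nat_bound ?size_polyX. Qed.

Lemma size_dvg k n p : (size p <= n)%N -> (size (dvg k p) <= n.+1)%N.
Proof.
case: n => [|n sp].
  rewrite leqn0 size_poly_eq0 => /eqP ->.
  by rewrite /dvg deriv0 !mulr0 subr0 size_poly0.
rewrite size_sub_bound //.
  by rewrite (@size_mul_bound 2) ?size_rho2 ?size_deriv_bound.
by rewrite (@size_mul_bound 1 n.+1) ?size_natX.
Qed.

Lemma size_pearson s k n p : (size p <= n)%N -> (size (pearson al s k p) <= n.+2)%N.
Proof.
move=> sp; apply: size_add_bound.
  apply: (@size_mul_bound 2 n) => //.
  by apply: (@size_mul_bound 0 3); rewrite ?size_polyC_leq1 ?size_rho2.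
by apply: (@size_mul_bound 1 n.+1); rewrite ?size_XsubC ?size_dvg.
Qed.

Lemma size_theta s n p : (size p <= n)%N -> (size (s%:P * p + Xa * p^`())%R <= n)%N.
Proof.
case: n => [|n sp].
  rewrite leqn0 size_poly_eq0 => /eqP ->.
  by rewrite deriv0 !mulr0 addr0 size_poly0.
apply: size_add_bound.
  by apply: (@size_mul_bound 0 n.+1); rewrite ?size_polyC_leq1.
by apply: (@size_mul_bound 1 n); rewrite ?size_XsubC ?size_deriv_bound.
Qed.

Lemma size_dphi0 k n p : (size p <= n)%N ->
  (size (- (1 - 'X ^+ 2) * p^`() + k%:R * 'X * p)%R <= n.+1)%N.
Proof.
case: n => [|n sp].
  rewrite leqn0 size_poly_eq0 => /eqP ->.
  by rewrite deriv0 !mulr0 addr0 size_poly0.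
apply: size_add_bound; last by apply: (@size_mul_bound 1 n.+1); rewrite ?size_natX.
by apply: (@size_mul_bound 2 n); rewrite ?size_polyN ?size_rho2 ?size_deriv_bound.
Qed.

Lemma size_dphi s k n p : (size p <= n)%N -> (size (dphi al s k p) <= n.+2)%N.
Proof.
move=> sp; apply: size_add_bound.
  by apply: (@size_mul_bound 2 n); rewrite ?size_polyN ?size_rho2 ?size_theta.
apply: (@size_mul_bound 2 n) => //.
by apply: (@size_mul_bound 1 2); rewrite ?size_natX ?size_XsubC.
Qed.

Lemma size_lap s k n p : (size p <= n)%N -> (size (lap al s k p) <= n.+2)%N.
Proof.
move=> sp; apply: size_sub_bound; first by rewrite size_pearson ?size_theta.
apply: (@size_mul_bound 2 n) => //.
by apply: (@size_mul_bound 0 3); rewrite ?size_nat_bound ?size_Xa_exp.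
Qed.

(** Differentiation lowers the degree and [dvg] raises it back. This yields the zero bandwidths of
    the two Laplacian matrices. *)
Lemma size_lap_diag k n p : (size p <= n)%N ->
  (size (dvg k p^`() - (k * k.+1)%:R * p)%R <= n)%N.
Proof.
case: n => [|n sp].
  rewrite leqn0 size_poly_eq0 => /eqP ->.
  by rewrite /dvg !deriv0 !mulr0 !subr0 size_poly0.
rewrite size_sub_bound ?size_dvg ?size_deriv_bound //.
by rewrite (@size_mul_bound 0) ?size_nat_bound.
Qed.

End SizeBounds.

(** * Banded coefficients in the orthonormal bases *)

Section BandedCoefficients.
Context {R : realType} (al : R).
Hypothesis al1 : -1 < al < 1.
Context (Rp : R -> R -> nat -> {poly R}).
Hypothesis hRp : forall a b : R, -1 < a -> 0 <= b ->
  orthonormal_polys al a b (Rp a b).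

Local Notation mu := (@lebesgue_measure R).
Local Notation Xa := ('X - al%:P).
Local Notation P b k := (Rp b (2 * k)%N%:R).

(** The inner product depends on its arguments only through their product, so it is encoded as a
    linear form on one polynomial. *)
Definition coef_fun (b : R) (k : nat) (p : {poly R}) : R :=
  (omegaR al b (2 * k)%N%:R)^-1 * wint al b k p.

Lemma orthonormalP b k : -1 < b -> orthonormal_polys al b (2 * k)%N%:R (P b k).
Proof. by move=> b1; apply: hRp. Qed.

Lemma size_orthonormal b k n : -1 < b -> size (P b k n) = n.+1.
Proof. by move=> /(orthonormalP k)[+ _]. Qed.

Lemma integrable_weight b k : -1 < b -> mu.-integrable `[al, 1]%classic (EFin \o weight al b k).
Proof. by move=> /(orthonormalP k); exact: orthonormal_integrable. Qed.

Lemma coef_fun_linear b k c p q : -1 < b ->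
  coef_fun b k (c *: p + q) = c * coef_fun b k p + coef_fun b k q.
Proof.
by move=> /(integrable_weight k) iw; rewrite /coef_fun wint_linear //; ring.
Qed.

Lemma coef_fun_orthonormal b k m n : -1 < b ->
  coef_fun b k (P b k m * P b k n) = (m == n)%:R.
Proof.
move=> /(orthonormalP k)[_ <-]; rewrite /inner_wR /coef_fun; congr (_ * _).
by apply: eq_Rintegral => z; rewrite inE /= => zi; rewrite hornerM wRE.
Qed.

Lemma wint_low_degree b k n (h : {poly R}) : -1 < b -> (size h <= n)%N ->
  wint al b k (P b k n * h) = 0.
Proof.
move=> b1 sh; have /eqP : coef_fun b k (P b k n * h) = 0.
  apply: orthonormal_low_degree sh; first by move=> *; exact: coef_fun_linear.
    by move=> ?; exact: size_orthonormal.
  by move=> *; exact: coef_fun_orthonormal.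
(* Since [0^-1 = 0], a vanishing [omegaR] would make [coef_fun] zero, against [<P_0, P_0> = 1]. *)
rewrite mulf_eq0 invr_eq0 => /orP[/eqP o0|/eqP //].
have := coef_fun_orthonormal k 0 0 b1.
by rewrite /coef_fun o0 invr0 mul0r => /eqP; rewrite eq_sym oner_eq0.
Qed.

Lemma coef_fun_expansion b k n (q : {poly R}) : -1 < b -> (size q <= n)%N ->
  q = \sum_(j < n) coef_fun b k (q * P b k j) *: P b k j.
Proof.
move=> b1; apply: orthonormal_expansion; first by move=> *; exact: coef_fun_linear.
  by move=> ?; exact: size_orthonormal.
by move=> *; exact: coef_fun_orthonormal.
Qed.

Lemma wintD b k p q : -1 < b ->
  wint al b k (p + q) = wint al b k p + wint al b k q.
Proof.
by move=> b1; rewrite -[p in LHS]scale1r wint_linear ?mul1r //; exact: integrable_weight.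
Qed.

Lemma wintN b k p : -1 < b -> wint al b k (- p) = - wint al b k p.
Proof.
move=> b1; have w0 : wint al b k 0 = 0.
  have := wintD k 0 0 b1; rewrite addr0 => /eqP.
  by rewrite -subr_eq0 opprD addNKr oppr_eq0 => /eqP.
by apply/eqP; rewrite -addr_eq0 -wintD // addNr w0.
Qed.

(** The exponent [k.+1] ensures vanishing at 1 even for [k = 0]; [0 < s] handles [al]. *)
Lemma wint_pearson s k G : 0 < s -> wint al (s - 1) k (pearson al s k G) = 0.
Proof.
move=> s0; pose H := (1 - 'X ^+ 2) ^+ k.+1 * G.
have H1 : H.[1] = 0 by rewrite /H hornerM horner_exp !hornerE expr1n subrr expr0n mul0r.
have fE : (fun z => (z - al) `^ (s - 1) * (s *: H + Xa * H^`()).[z]) =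
          (fun z => (pearson al s k G).[z] * weight al (s - 1) k z).
  apply/funext => z; rewrite -mul_polyC pearsonE /weight.
  rewrite hornerM horner_exp hornerD hornerN hornerXn -polyC1 hornerC; ring.
have := powR_horner_integral0 al1 s0 H1; rewrite /= fE; apply.
by apply: integrable_horner_weight => //; apply: integrable_weight; lra.
Qed.

(* The coefficients of [p] in the basis [P b k] are then supported on the degrees
   between [n - u] and [n + l]. *)
Definition degree_band (b : R) (k l u n : nat) (p : {poly R}) : Prop :=
  (size p <= n.+1 + l)%N /\
  forall g : {poly R}, (size g + u <= n)%N -> wint al b k (p * g) = 0.

Lemma degree_band_coef b k l u n p j : -1 < b -> degree_band b k l u n p ->
  (j + u < n)%N -> coef_fun b k (p * P b k j) = 0.
Proof.
move=> b1 [_ op] ju; rewrite /coef_fun op ?mulr0 // size_orthonormal //.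
Qed.

Lemma dphi0_band a k n : 0 <= a ->
  degree_band (a + 1) k 1 2 n
    (- (1 - 'X ^+ 2) * (P a k n)^`() + k%:R * 'X * P a k n).
Proof.
move=> a0; have a1 : -1 < a by lra.
split=> [|g sg]; first by rewrite addn1; apply: size_dphi0; rewrite size_orthonormal.
rewrite -[a + 1]/(a + 1%:R) wint_shift // expr1 (dphi0_by_parts _ (a + 1)).
rewrite wintD // wintN // -[X in wint _ X](addrK 1 a) wint_pearson; last by lra.
rewrite oppr0 add0r addrK wint_low_degree //; apply: leq_trans sg.
rewrite addn2; apply: size_add_bound; first exact: size_pearson.
apply: (@size_mul_bound _ 2) => //.
by apply: (@size_mul_bound _ 1 2); rewrite ?size_natX ?size_XsubC.
Qed.

Lemma dphi_band a k n : 0 < a -> degree_band (a - 1) k 2 1 n (dphi al a k (P a k n)).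
Proof.
move=> a0; have a1 : -1 < a by lra.
have a2 : -1 < a - 1 by lra.
split=> [|g sg]; first by rewrite addn2; apply: size_dphi; rewrite size_orthonormal.
rewrite dphi_by_parts wintD // wintN // wint_pearson // oppr0 add0r.
have /= <- := @wint_shift _ _ (a - 1) 1 k; rewrite subrK wint_low_degree //.
apply: leq_trans sg; rewrite addn1.
apply: size_add_bound; first exact: size_dvg.
by apply: (@size_mul_bound _ 1); rewrite ?size_natX.
Qed.

Lemma lap0_band a k ta n : 0 <= a -> (2 <= ta)%N ->
  degree_band (a + ta%:R) k 0 ta n
    (dvg k (P a k n)^`() - (k * k.+1)%:R * P a k n).
Proof.
move=> a0 hta; have a1 : -1 < a by lra.
split=> [|g sg]; first by rewrite addn0; apply: size_lap_diag; rewrite size_orthonormal.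
set s := a + ta%:R.
have s2 : 2 <= s by rewrite /s -[2]/(2%:R) -[leLHS]add0r lerD // ler_nat.
have -> : s = s - 1 - 1 + 2%:R by ring.
have s3 : -1 < s - 1 - 1 by lra.
rewrite wint_shift // (lap0_by_parts _ s) !wintD // wintN // wint_pearson ?subr0; last by lra.
have /= := @wint_shift _ al (s - 1 - 1) 1 k; rewrite expr1 subrK => <-.
rewrite wint_pearson ?add0r; last by lra.
(* Both integrations by parts used up two of the [ta] extra factors; the other [ta - 2] are moved
   onto the test polynomial to return to the weight of [P a k n]. *)
have -> : s - 1 - 1 = a + (ta - 2)%:R by rewrite /s natrB //; ring.
rewrite wint_shift // mulrCA wint_low_degree //; apply: leq_trans sg.
rewrite (_ : size g + ta = (ta - 2) + (size g).+2)%N; last by lia.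
apply: size_mul_bound; first exact: size_Xa_exp.
apply: size_sub_bound.
  apply: size_pearson; rewrite addrC; exact: size_theta.
apply: (@size_mul_bound _ 2) => //.
by apply: (@size_mul_bound _ 0 3); rewrite ?size_nat_bound ?size_Xa_exp.
Qed.

Lemma lap_band a k ta n : 2 <= a -> (2 <= ta)%N -> -1 < a - ta%:R ->
  degree_band (a - ta%:R) k ta 0 n (Xa ^+ (ta - 2) * lap al a k (P a k n)).
Proof.
move=> a2 hta ata; have a1 : -1 < a by lra.
split=> [|g].
  rewrite (_ : n.+1 + ta = (ta - 2) + n.+3)%N; last by lia.
  apply: size_mul_bound; first exact: size_Xa_exp.
  by apply: size_lap; rewrite size_orthonormal.
rewrite addn0 => sg; rewrite -mulrA -wint_shift.
have -> : a - ta%:R + (ta - 2)%:R = a - 1 - 1 by rewrite natrB //; ring.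
have s3 : -1 < a - 1 - 1 by lra.
rewrite lap_by_parts wintD // wintD // wintN // wint_pearson ?add0r; last by lra.
have /= := @wint_shift _ al (a - 1 - 1) 1 k; rewrite expr1 subrK => <-.
rewrite wint_pearson ?oppr0 ?add0r; last by lra.
have /= <- := @wint_shift _ al (a - 1 - 1) 2 k.
have -> : a - 1 - 1 + 2 = a by ring.
by rewrite wint_low_degree // (leq_trans _ sg) // size_lap_diag.
Qed.

Lemma lap1_band k n :
  degree_band 1 k 1 1 n
    (dvg k (P 1 k n + Xa * (P 1 k n)^`()) - (k * k.+1)%:R * Xa * P 1 k n).
Proof.
have a1 : -1 < 1 :> R by lra.
split=> [|g sg].
  rewrite addn1; apply: size_sub_bound.
    by apply: size_dvg; rewrite -[X in X + _]mul1r -polyC1 size_theta ?size_orthonormal.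
  apply: (@size_mul_bound _ 1); last by rewrite size_orthonormal.
  by apply: (@size_mul_bound _ 0 2); rewrite ?size_nat_bound ?size_XsubC.
have shift p : wint al 1 k p = wint al (1 - 1) k (Xa * p).
  by have /= <- := @wint_shift _ al (1 - 1) 1 k p; rewrite subrK.
have b1 : -1 < 1 - 1 :> R by lra.
rewrite shift mulrCA lap1_by_parts wintD // wintD // wintN // !wint_pearson ?subr0 ?add0r; try lra.
rewrite -shift wint_low_degree //; apply: leq_trans sg; rewrite addn1.
apply: size_lap_diag; apply: (@size_mul_bound _ 1) => //.
by rewrite size_XsubC.
Qed.

End BandedCoefficients.

(** * Block indices and operator matrices *)

Section BlockIndices.
Local Open Scope nat_scope.
Context (N : nat).
Local Notation sz := (\sum_(k < N.+1) block_size k).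

Definition mode (p : 'I_sz) : 'I_N.+1 := tagnat.sig1 p.
Definition deg (p : 'I_sz) : nat := entry_deg (mode p) (tagnat.sig2 p).
Definition par (p : 'I_sz) : nat := entry_par (mode p) (tagnat.sig2 p).

Definition position (k n i : nat) : nat := if k == 0 then n else (n - k).*2 + i.

Lemma entry_degK k q : position k (entry_deg k q) (entry_par k q) = q.
Proof.
rewrite /position /entry_deg /entry_par; case: eqP => // _.
by rewrite addKn addnC odd_double_half.
Qed.

Lemma Rank_eq (k k' : 'I_N.+1) (x : 'I_(block_size k)) (y : 'I_(block_size k')) :
  k = k' -> x = y :> nat -> tagnat.Rank k x = tagnat.Rank k' y.
Proof. by move=> kk'; subst k' => /val_inj ->. Qed.

Lemma position_sig2 (p : 'I_sz) : position (mode p) (deg p) (par p) = tagnat.sig2 p.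
Proof. exact: entry_degK. Qed.

Lemma mode_deg_par_inj (p q : 'I_sz) :
  mode p = mode q -> deg p = deg q -> par p = par q -> p = q.
Proof.
move=> mpq dpq ppq; rewrite -[p]tagnat.sig2K -[q]tagnat.sig2K.
by apply: Rank_eq => //; rewrite -!position_sig2 mpq dpq ppq.
Qed.

Lemma entry_deg_bounds (k : 'I_N.+1) (q : 'I_(block_size k)) :
  k <= entry_deg k q <= N.
Proof.
case: q => q /=; rewrite /entry_deg /block_size; have := ltn_ord k.
case: eqP => [-> _|_ kN qk]; first by rewrite ltnS.
rewrite leq_addr /=; move: qk; rewrite -ltn_half_double; lia.
Qed.

Lemma deg_bounds (p : 'I_sz) : mode p <= deg p <= N.
Proof. exact: entry_deg_bounds. Qed.

Lemma par_bound p : par p < (0 < mode p).+1.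
Proof.
rewrite /par /entry_par lt0n; case: eqP => //= _.
by case: odd.
Qed.

Lemma par_lt2 (p : 'I_sz) : par p < 2.
Proof. by apply: leq_trans (par_bound p) _; case: (0 < mode p). Qed.

End BlockIndices.

(** * Reindexing sums over matrix entries by mode, degree and parity *)

Section BlockSums.
Context {V : nmodType} (N : nat).
Local Notation sz := (\sum_(k < N.+1) block_size k)%N.

Lemma sum_double n (F : nat -> V) :
  \sum_(q < n.*2) F q = \sum_(m < n) (F m.*2 + F m.*2.+1).
Proof.
elim: n => [|n IH]; first by rewrite !big_ord0.
by rewrite doubleS !big_ord_recr /= IH addrA.
Qed.

Lemma block_sum (k : 'I_N.+1) (G : nat -> nat -> V) :
  \sum_(q < block_size k) G (entry_deg k q) (entry_par k q) =
  \sum_(m < N.+1 | (k <= m)%N) \sum_(i < (0 < k).+1) G m i.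
Proof.
rewrite /block_size /entry_deg /entry_par lt0n; case: eqP => [k0|k0] /=.
  rewrite k0; apply: eq_big => // m _; by rewrite big_ord1.
rewrite (sum_double (N - k).+1 (fun q => G (k + q./2)%N (odd q))).
rewrite -(big_mkord (fun m => k <= m)%N (fun m => \sum_(i < 2) G m i)).
rewrite -(big_nat_widenl k 0 N.+1 xpredT) //.
rewrite -[X in \big[_/_]_(X <= _ < _) _]add0n big_addn subSn ?big_mkord; last by rewrite -ltnS.
apply: eq_bigr => m _; rewrite !big_ord_recl big_ord0 /= addr0.
by rewrite uphalf_double doubleK odd_double !(addnC k).
Qed.

Lemma index_sum (G : 'I_N.+1 -> nat -> nat -> V) :
  \sum_(p < sz) G (mode p) (deg p) (par p) =
  \sum_(k < N.+1) \sum_(m < N.+1 | (k <= m)%N) \sum_(i < (0 < k).+1) G k m i.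
Proof.
under [RHS]eq_bigr do rewrite -block_sum.
by rewrite sig_big_dep/= (reindex _ tagnat.sig_bij_on).
Qed.

(** Vectors are grouped by mode, whereas [high_degree] sums by degree; this passes from one order to
    the other. *)
Lemma triangle_sum (G : nat -> nat -> nat -> V) :
  \sum_(k < N.+1) \sum_(m < N.+1 | (k <= m)%N) \sum_(i < (0 < k).+1) G m k i =
  \sum_(m < N.+1) \sum_(k < m.+1) \sum_(i < (0 < k).+1) G m k i.
Proof.
under eq_bigr do rewrite big_mkcond.
rewrite exchange_big /=; apply: eq_bigr => m _.
by rewrite -big_mkcond (big_ord_widen _ (fun k => \sum_(i < (0 < k).+1) G m k i) (ltn_ord m)).
Qed.

End BlockSums.

(** * Existence, uniqueness and bands of an operator matrix *)

Section OperatorMatrixCriterion.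
Context {R : realType} (al : R) (N : nat).
Local Notation sz := (\sum_(k < N.+1) block_size k)%N.
Implicit Types (B : Defs.basis R) (v : 'cV[R]_sz).

Lemma expansionE B v phi theta : expansion B v phi theta =
  \sum_p v p 0 * B (deg p) (mode p) (par p) phi theta.
Proof.
rewrite /expansion mxE; apply: eq_bigr => p _.
by rewrite /Qtilde !mxE mulrC.
Qed.

(** At most one term occurs; the sum form gives 0 at triples that index no entry. *)
Definition coef v (m k i : nat) : R :=
  \sum_(p | [&& mode p == k :> nat, deg p == m & par p == i]) v p 0.

Lemma coefE v p : coef v (deg p) (mode p) (par p) = v p 0.
Proof.
rewrite /coef (bigD1 p) ?eqxx //= [X in _ + X]big1 ?addr0 // => q.
move=> /andP[/and3P[/eqP mq /eqP dq /eqP pq]].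
by rewrite (mode_deg_par_inj (val_inj mq) dq pq) eqxx.
Qed.

Lemma expansion_triangle B v phi theta : expansion B v phi theta =
  \sum_(0 <= m < N.+1) \sum_(k < m.+1) \sum_(i < (0 < k)%N.+1)
    coef v m k i * B m k i phi theta.
Proof.
rewrite expansionE big_mkord -(triangle_sum N (fun m k i => coef v m k i * B m k i phi theta)).
rewrite -(index_sum (fun k m i => coef v m k i * B m k i phi theta)).
by apply: eq_bigr => p _; rewrite coefE.
Qed.

(** All degrees are covered, not only those up to [N]: retained terms must be separated from the
    dropped ones. *)
Definition independent B : Prop := forall M (d : nat -> nat -> nat -> R),
  (forall phi theta, cap_phi al phi ->
    \sum_(0 <= n < M) \sum_(k < n.+1) \sum_(i < (0 < k)%N.+1)
      d n k i * B n k i phi theta = 0) ->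
  forall n k i, (n < M)%N -> (k <= n)%N -> (i < (0 < k)%N.+1)%N -> d n k i = 0.

Lemma high_degreeB B r1 r2 : high_degree al N B r1 -> high_degree al N B r2 ->
  high_degree al N B (fun phi theta => r1 phi theta - r2 phi theta).
Proof.
move=> [M1 [c1 r1E]] [M2 [c2 r2E]]; exists (maxn M1 M2).
pose trunc (M : nat) (c : nat -> nat -> nat -> R) n k i : R :=
  if (n < M)%N then c n k i else 0.
exists (fun n k i => trunc M1 c1 n k i - trunc M2 c2 n k i) => phi theta hphi.
have widen M (c : nat -> nat -> nat -> R) : (M <= maxn M1 M2)%N ->
    \sum_(N.+1 <= n < M) \sum_(k < n.+1) \sum_(i < (0 < k)%N.+1)
      c n k i * B n k i phi theta =
    \sum_(N.+1 <= n < maxn M1 M2) \sum_(k < n.+1) \sum_(i < (0 < k)%N.+1)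
      trunc M c n k i * B n k i phi theta.
  move=> /(big_nat_widen _ _ _ _ _) ->; rewrite big_mkcond /=.
  apply: eq_bigr => n _; rewrite /trunc; case: ltnP => // _.
  by rewrite big1 // => k _; rewrite big1 // => i _; rewrite mul0r.
rewrite r1E // r2E // (widen M1) ?leq_maxl // (widen M2) ?leq_maxr //.
rewrite -sumrB; apply: eq_bigr => n _; rewrite -sumrB; apply: eq_bigr => k _.
by rewrite -sumrB; apply: eq_bigr => i _; rewrite mulrBl.
Qed.

Lemma independent_expansion0 B v r : independent B -> high_degree al N B r ->
  (forall phi theta, cap_phi al phi -> expansion B v phi theta = r phi theta) -> v = 0.
Proof.
move=> indB [M [c rE]] vE.
have MN : (N.+1 <= maxn M N.+1)%N by rewrite leq_maxr.
(* The two sides of [vE] form one relation: [v] up to degree [N], minus the remainder above. *)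
pose d n k i := if (n < N.+1)%N then coef v n k i else - c n k i.
have d0 := indB (maxn M N.+1) d.
apply/matrixP => p j; rewrite ord1 [RHS]mxE -coefE.
have /andP[kd dN] := deg_bounds p.
have := d0 _ (deg p) (mode p) (par p); rewrite /d (ltnS (deg p) N) dN; apply=> //.
- move=> phi theta hphi; rewrite (big_cat_nat (leq0n N.+1) MN) /=.
  rewrite (eq_big_nat _ _ (F2 := fun m => \sum_(k < m.+1) \sum_(i < (0 < k)%N.+1)
    coef v m k i * B m k i phi theta)); last by move=> n /andP[_ ->].
  rewrite -expansion_triangle vE // rE //.
  rewrite [X in _ + X](eq_big_nat _ _ (F2 := fun m => - \sum_(k < m.+1) \sum_(i < (0 < k)%N.+1)
    c m k i * B m k i phi theta)); last first.
    move=> n /andP[Nn _]; rewrite ltnNge Nn /= -sumrN; apply: eq_bigr => k _.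
    by rewrite -sumrN; apply: eq_bigr => i _; rewrite mulNr.
  rewrite sumrN; have [MN1|/ltnW NM] := leqP M N.+1; last by rewrite subrr.
  by rewrite !big_geq // oppr0 addr0.
- exact: leq_trans MN.
- exact: par_bound.
Qed.

Lemma operator_matrix_inj T src tgt A A' : independent tgt ->
  operator_matrix al (N := N) T src tgt A -> operator_matrix al T src tgt A' -> A = A'.
Proof.
move=> ind hA hA'.
suff eqA v : A *m v = A' *m v.
  by apply/trmx_inj/row_matrixP => i; rewrite !rowE -[delta_mx _ _]trmxK -!trmx_mul eqA.
apply/eqP; rewrite -subr_eq0; apply/eqP.
have [r [hr rE]] := hA v; have [r' [hr' rE']] := hA' v.
apply: (independent_expansion0 ind (high_degreeB hr' hr)) => phi theta hphi.
have := rE _ theta hphi; rewrite rE' // !expansionE.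
move: (A *m v) (A' *m v) => w w' ww'.
under eq_bigr do rewrite !mxE mulrBl.
by rewrite sumrB; lra.
Qed.

Lemma sum_pick n k0 i0 (F : nat -> nat -> R) :
  (k0 < n)%N -> (i0 < (0 < k0)%N.+1)%N ->
  \sum_(k < n) \sum_(i < (0 < k)%N.+1)
    (if (k == k0 :> nat) && (i == i0 :> nat) then F k i else 0) = F k0 i0.
Proof.
move=> k0n i0k; rewrite (bigD1 (Ordinal k0n)) //= [X in _ + X]big1 ?addr0.
  rewrite (bigD1 (Ordinal i0k)) //= !eqxx big1 ?addr0 // => i.
  by rewrite -val_eqE /= => /negbTE ->.
by move=> k; rewrite -val_eqE /= => /negbTE ->; rewrite big1.
Qed.

(** The image of entry [j] stays in its mode and has a single index [par' j], which differs from
    [par j] only for [d/dtheta]. Its terms [t j m] with [m <= N] fill column [j]; those with [m > N]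
    form the remainder. *)
Lemma banded_operator T src tgt l u M (t : 'I_sz -> nat -> R) (par' : 'I_sz -> nat) :
  independent tgt -> (N < M)%N ->
  (forall j, (par' j < (0 < mode j)%N.+1)%N) ->
  (forall v phi theta, cap_phi al phi -> T (expansion src v) phi theta =
    \sum_j v j 0 * \sum_(0 <= m < M | (mode j <= m)%N)
      t j m * tgt m (mode j) (par' j) phi theta) ->
  (forall j m, (mode j <= m)%N -> (m <= N)%N -> t j m != 0 ->
    in_band l u (position (mode j) m (par' j)) (tagnat.sig2 j)) ->
  exists A : 'M[R]_sz,
    unique (operator_matrix al T src tgt) A /\
    block_diagonal A /\ sub_block_bandwidths A l u.
Proof.
move=> ind NM par'P TE bandP.
pose A : 'M[R]_sz := \matrix_(p, j)
  if (mode p == mode j :> nat) && (par p == par' j) then t j (deg p) else 0.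
have nzA p j : A p j != 0 ->
    mode p = mode j /\ in_band l u (tagnat.sig2 p) (tagnat.sig2 j).
  rewrite mxE; case: ifP => [/andP[/eqP/val_inj mpj /eqP ppj] tn0|_]; last by rewrite eqxx.
  split=> //; have /andP[md dN] := deg_bounds p.
  have := bandP j (deg p); rewrite -ppj -mpj position_sig2; exact.
have opA : operator_matrix al T src tgt A.
  move=> v.
  exists (fun phi theta => \sum_j v j 0 * \sum_(N.+1 <= m < M)
    t j m * tgt m (mode j) (par' j) phi theta); split.
    exists M, (fun n k i => \sum_j
      if (k == mode j :> nat) && (i == par' j) then v j 0 * t j n else 0) => phi theta _.
    under eq_bigr do rewrite mulr_sumr.
    rewrite exchange_big /=; apply: eq_big_nat => n /andP[Nn _].
    under [RHS]eq_bigr do under eq_bigr do rewrite mulr_suml.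
    under [RHS]eq_bigr do rewrite exchange_big /=.
    rewrite exchange_big /=; apply: eq_bigr => j _.
    rewrite mulrA -(@sum_pick n.+1 (mode j) (par' j)
      (fun k i => v j 0 * t j n * tgt n k i phi theta)) ?par'P //.
      by apply: eq_bigr => k _; apply: eq_bigr => i _; case: ifP; rewrite // mul0r.
    by rewrite ltnS (leq_trans _ (ltnW Nn)) // -ltnS ltn_ord.
  move=> phi theta hphi; rewrite TE // expansionE.
  under [X in _ = X + _]eq_bigr do rewrite mxE mulr_suml.
  rewrite exchange_big /= -big_split /=; apply: eq_bigr => j _.
  have colE : \sum_p A p j * tgt (deg p) (mode p) (par p) phi theta =
      \sum_(m < N.+1 | (mode j <= m)%N) t j m * tgt m (mode j) (par' j) phi theta.
    pose G (k : 'I_N.+1) m i := (if (k == mode j :> nat) && (i == par' j) then t j m else 0)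
      * tgt m k i phi theta.
    transitivity (\sum_(p < sz) G (mode p) (deg p) (par p)).
      by apply: eq_bigr => p _; rewrite mxE.
    rewrite index_sum (bigD1 (mode j)) //= [X in _ + X]big1 ?addr0.
      apply: eq_bigr => m _; rewrite (bigD1 (Ordinal (par'P j))) //= /G !eqxx /=.
      rewrite [X in _ + X]big1 ?addr0 // => i.
      by rewrite -val_eqE /= => /negbTE ->; rewrite mul0r.
    move=> k; rewrite -val_eqE /= => /negbTE kj.
    by rewrite big1 // => m _; rewrite big1 // => i _; rewrite /G kj mul0r.
  transitivity (v j 0 * (\sum_p A p j * tgt (deg p) (mode p) (par p) phi theta
    + \sum_(N.+1 <= m < M) t j m * tgt m (mode j) (par' j) phi theta)).
    congr (_ * _); rewrite colE (big_cat_nat (leq0n N.+1) NM) /= big_mkord.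
    congr (_ + _); rewrite big_mkcond; apply: eq_big_nat => m /andP[Nm _].
    by rewrite ifT // (leq_trans _ (ltnW Nm)) // -ltnS.
  rewrite mulrDr mulr_sumr; congr (_ + _); apply: eq_bigr => p _.
  by rewrite mulrCA mulrA.
exists A; split; [split=> // A' hA'|split].
- exact: operator_matrix_inj opA hA'.
- move=> i j ij; apply/matrixP => p q; rewrite [RHS]mxE mxE.
  apply/eqP/negPn/negP => /nzA[+ _]; rewrite /mode !tagnat.Rank1K => mij.
  by move: ij; rewrite mij /in_band !addn0 leqnn.
- move=> i j p q pq; rewrite mxE; apply/eqP/negPn/negP => /nzA[_].
  by rewrite !tagnat.Rank2K /= (negbTE pq).
Qed.

End OperatorMatrixCriterion.

(** * Differentiation on the cap *)

Section CapFunctions.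
Local Open Scope classical_set_scope.
Local Open Scope ring_scope.
Context {R : realType} (al : R).

(** [sin phi] stands for [rho (cos phi)], its equal on the cap, so that no square root is
    differentiated. *)
Definition capf (s : R) (p : {poly R}) (k i : nat) : cap_fun R :=
  fun phi theta => (cos phi - al) `^ s * p.[cos phi] * sin phi ^+ k * Y k i theta.

Lemma cap_phi_sin phi : cap_phi al phi -> 0 < sin phi.
Proof. by case/and3P => p0 ppi _; rewrite sin_gt0_pi ?p0. Qed.

Lemma cap_phi_cos phi : cap_phi al phi -> al < cos phi.
Proof. by case/and3P. Qed.

Lemma rho_cos phi : cap_phi al phi -> rho (cos phi) = sin phi.
Proof.
move=> /cap_phi_sin sp; rewrite /rho -(cos2Dsin2 phi) addrC addKr.
by rewrite sqrtr_sqr gtr0_norm.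
Qed.

Lemma near_cap_phi phi : cap_phi al phi -> \forall x \near phi, cap_phi al x.
Proof.
case/and3P => p0 ppi pal; near=> x; apply/and3P; split; near: x.
- exact: lt_nbhsr.
- exact: lt_nbhsl.
- by apply: (cvgr_gt _ (@continuous_cos R phi)).
Unshelve. all: by end_near. Qed.

Lemma Q_capf (Rp : R -> R -> nat -> {poly R}) a n k i phi theta : cap_phi al phi ->
  Q Rp a n k i phi theta = capf 0 (Rp a (2 * k)%N%:R (n - k)%N) k i phi theta.
Proof. by move=> hphi; rewrite /Q /capf powRr0 mul1r rho_cos. Qed.

Lemma weighted_Q_capf (Rp : R -> R -> nat -> {poly R}) s a n k i phi theta : cap_phi al phi ->
  weighted al s (Q Rp a) n k i phi theta =
  capf s (Rp a (2 * k)%N%:R (n - k)%N) k i phi theta.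
Proof.
by move=> hphi; rewrite /weighted /wmul /wR powRr0 mulr1 Q_capf // /capf powRr0 mul1r !mulrA.
Qed.

Lemma capf_shift s m p k i phi theta : cap_phi al phi ->
  capf s (('X - al%:P) ^+ m * p) k i phi theta = capf (s + m%:R) p k i phi theta.
Proof.
move=> /cap_phi_cos ac; rewrite /capf powRD; last by rewrite subr_eq0 (gt_eqF ac) implybT.
rewrite powR_mulrn ?subr_ge0 ?ltW // hornerM horner_exp hornerXsubC; ring.
Qed.

Lemma horner_nat n (z : R) : (n%:R : {poly R}).[z] = n%:R.
Proof. by rewrite -(rmorph_nat (@polyC R)) hornerC. Qed.

Lemma is_derive_capf s p k i phi theta : cap_phi al phi ->
  is_derive phi 1 (fun x => capf s p k i x theta)
    ((sin phi)^-1 * capf (s - 1) (dphi al s k p) k i phi theta).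
Proof.
move=> hphi; have sp := cap_phi_sin hphi; have ac := cap_phi_cos hphi.
have d1 := @is_derive1_comp R (fun y => (y - al) `^ s * p.[y]) cos phi _ _
  (is_derive_powR_horner s p ac) (is_derive_cos phi).
have d2 := is_deriveX k (is_derive_sin phi).
have d3 := is_deriveM (is_deriveM d1 d2) (is_derive_cst (Y k i theta) phi 1).
have -> : (fun x => capf s p k i x theta) =
    ((fun y => (y - al) `^ s * p.[y]) \o cos) * (@sin R ^+ k) * cst (Y k i theta).
  by apply/funext => x; rewrite /capf !mulrfctE exprfctE.
apply: is_derive_eq.
rewrite /capf /dphi !(hornerD, hornerN, hornerM, hornerXn, hornerX, hornerC,
  hornerXsubC, hornerZ, horner_nat k, horner_nat 1) exprfctE /GRing.scale /=.
rewrite (powR_subr1 s ac) (_ : 1 - cos phi ^+ 2 = sin phi ^+ 2); last first.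
  by rewrite -(cos2Dsin2 phi) addrC addKr.
have s0 : sin phi != 0 by rewrite gt_eqF.
(* The derivative of [sin ^+ k] involves the truncated exponent [k.-1]. *)
case: k {d2 d3} => [|k] /=; first by rewrite !expr0; field.
by rewrite !exprS; field.
Qed.

Lemma is_derive_lincomb n (c : 'I_n -> R) (h : 'I_n -> R -> R) (dh : 'I_n -> R) (x : R) :
  (forall j, is_derive x 1 (h j) (dh j)) ->
  is_derive x 1 (fun y => \sum_j c j * h j y) (\sum_j c j * dh j).
Proof.
move=> hd; have := is_derive_sum (fun j => is_deriveZ (c j) (hd j)).
by congr is_derive; apply/funext => y; rewrite fct_sumE.
Qed.

(** The boolean [i == 0], read as a number, exchanges cosine and sine. *)
Lemma is_derive_Y (k i : nat) (theta : R) : is_derive theta 1 (Y k i : R -> R)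
  ((if i == 0%N then - k%:R else k%:R) * Y k (i == 0%N) theta).
Proof.
rewrite /Y; case: (k =P 0%N) => [->|_].
  by rewrite oppr0 if_same mul0r; exact: is_derive_cst.
have dk : is_derive theta 1 (fun x : R => k%:R * x) k%:R.
  by apply: is_derive_eq; rewrite /GRing.scale /= mulr1.
case: (i =P 0%N) => [_|_] /=.
  have := is_derive1_comp (is_derive_cos (k%:R * theta)) dk.
  by congr is_derive; ring.
have := is_derive1_comp (is_derive_sin (k%:R * theta)) dk.
by congr is_derive; ring.
Qed.

Section LinearCombinations.
Context (n : nat) (c : 'I_n -> R) (s : R) (p : 'I_n -> {poly R}) (k i : 'I_n -> nat).
Context (f : cap_fun R).
Hypothesis fE : forall phi theta, cap_phi al phi ->
  f phi theta = \sum_j c j * capf s (p j) (k j) (i j) phi theta.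

Lemma rho_partial_phi_capf phi theta : cap_phi al phi ->
  rho_partial_phi f phi theta =
  \sum_j c j * capf (s - 1) (dphi al s (k j) (p j)) (k j) (i j) phi theta.
Proof.
move=> hphi; rewrite /rho_partial_phi /partial_phi derive1E.
have d := is_derive_lincomb c (fun j => is_derive_capf s (p j) (k j) (i j) theta hphi).
have nfE : \forall x \near phi,
    \sum_j c j * capf s (p j) (k j) (i j) x theta = f x theta.
  by apply: filterS (near_cap_phi hphi) => x /fE ->.
have [_ ->] := near_eq_is_derive nfE d.
rewrite mulr_sumr; apply: eq_bigr => j _.
by rewrite mulrCA mulVKf // gt_eqF // cap_phi_sin.
Qed.

Lemma partial_theta_capf phi theta : cap_phi al phi ->
  partial_theta f phi theta =
  \sum_j c j * ((if i j == 0%N then - (k j)%:R else (k j)%:R)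
                * capf s (p j) (k j) (i j == 0%N) phi theta).
Proof.
move=> hphi; rewrite /partial_theta derive1E.
rewrite (_ : f phi = fun x => \sum_j c j * capf s (p j) (k j) (i j) phi x); last first.
  by apply/funext => x; exact: fE.
have dY j : is_derive theta 1 (fun x => capf s (p j) (k j) (i j) phi x)
    ((if i j == 0%N then - (k j)%:R else (k j)%:R)
     * capf s (p j) (k j) (i j == 0%N) phi theta).
  rewrite (_ : _ * _ = (cos phi - al) `^ s * (p j).[cos phi] * sin phi ^+ k j *
    ((if i j == 0%N then - (k j)%:R else (k j)%:R) * Y (k j) (i j == 0%N) theta)).
    by apply: is_deriveZ; exact: is_derive_Y.
  by rewrite /capf mulrCA.
by have [_ ->] := is_derive_lincomb c dY.
Qed.

End LinearCombinations.

Lemma laplaceS_capf n (c : 'I_n -> R) s (p : 'I_n -> {poly R}) (k i : 'I_n -> nat)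
    (f : cap_fun R) :
  (forall j, i j < 2)%N ->
  (forall phi theta, cap_phi al phi ->
    f phi theta = \sum_j c j * capf s (p j) (k j) (i j) phi theta) ->
  forall phi theta, cap_phi al phi ->
  laplaceS f phi theta =
  \sum_j c j * capf (s - 2) (lap al s (k j) (p j)) (k j) (i j) phi theta.
Proof.
move=> i2 fE phi theta hphi; rewrite /laplaceS.
have s0 : sin phi != 0 by rewrite gt_eqF // cap_phi_sin.
(* Both terms of the Laplacian now carry [sin^-2], ready for [dphi_dphi]. *)
have -> : partial_phi (rho_partial_phi f) phi theta =
    (sin phi)^-1 * rho_partial_phi (rho_partial_phi f) phi theta.
  by rewrite [X in _ * X]/rho_partial_phi mulKf.
rewrite (rho_partial_phi_capf (rho_partial_phi_capf fE) theta hphi).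
pose e j : R := if i j == 0%N then - (k j)%:R else (k j)%:R.
have f1E phi' theta' : cap_phi al phi' -> partial_theta f phi' theta' =
    \sum_j (c j * e j) * capf s (p j) (k j) (i j == 0%N) phi' theta'.
  by move=> h; rewrite (partial_theta_capf fE) //; apply: eq_bigr => j _; rewrite mulrA.
rewrite (partial_theta_capf f1E) // !mulr_sumr -big_split /=.
apply: eq_bigr => j _.
have -> : (if (i j == 0%N : nat) == 0%N then - (k j)%:R else (k j)%:R) = - e j.
  by rewrite /e; case: (i j == 0%N) => /=; rewrite ?opprK.
(* Exchanging cosine and sine twice restores [i j] only because it is 0 or 1. *)
have -> : ((i j == 0%N : nat) == 0%N) = i j :> nat.
  by have := i2 j; case: (i j) => [|[|]].
have eE : e j * - e j = - ((k j) ^ 2)%:R.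
  by rewrite /e natrX; case: eqP => _; ring.
have ac := cap_phi_cos hphi.
move: (dphi_dphi al s (k j) (p j)).
move: (dphi al (s - 1) _ _) (lap al s _ _) => A L.
move=> /(congr1 (horner^~ (cos phi))); rewrite /= !(hornerXn, horner_exp,
  hornerXsubC, hornerD, hornerN, hornerM, horner_nat (k j ^ 2), horner_nat 1).
rewrite (_ : 1 - cos phi ^+ 2 = sin phi ^+ 2); last first.
  by rewrite -(cos2Dsin2 phi) addrC addKr.
move=> /eqP; rewrite subr_eq => /eqP lapE.
rewrite /capf (powR_subr1 s ac) (powR_subr1 (s - 1) ac).
have -> : s - 1 - 1 = s - 2 by ring.
rewrite lapE [c j * e j * _]mulrA -(mulrA (c j) (e j)) eE.
by field.
Qed.

End CapFunctions.

(** * Linear independence on the cap *)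

Section TrigonometricIndependence.
Context {R : realType}.

Lemma cosDB (x h : R) : cos (x + h) + cos (x - h) = 2 * cos h * cos x.
Proof. by rewrite !cosD cosN sinN; ring. Qed.

Lemma sinDB (x h : R) : sin (x + h) + sin (x - h) = 2 * cos h * sin x.
Proof. by rewrite !sinD cosN sinN; ring. Qed.

(* The combination [f (theta + h) + f (theta - h) - 2 cos (K h) f theta] kills the
   component of frequency [K], and for [h = pi / K] no lower frequency. *)
Lemma dalembert_independent K (g : nat -> R -> R) :
  (forall k theta h, g k (theta + h) + g k (theta - h) = 2 * cos (k%:R * h) * g k theta) ->
  (forall theta, \sum_(k < K) g k theta = 0) ->
  forall k theta, (k < K)%N -> g k theta = 0.
Proof.
elim: K g => [//|K IH] g gD g0 k theta.
have [K0|K0] := posnP K.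
  move=> kK; have k0 : k = 0%N by lia.
  by have := g0 theta; rewrite k0 {k kK k0} K0 big_ord1.
pose h : R := pi / K%:R.
have Kh : K%:R * h = pi by rewrite /h mulrCA divff ?mulr1 // pnatr_eq0 -lt0n.
have lowg k' theta' : (k' < K)%N -> g k' theta' = 0.
  move=> kK.
  have /eqP : (cos (k'%:R * h) - cos (K%:R * h)) * g k' theta' = 0.
    apply: (IH (fun k x => (cos (k%:R * h) - cos (K%:R * h)) * g k x)) => //.
      by move=> j x u; rewrite -mulrDr gD; ring.
    move=> x.
    have : \sum_(j < K.+1) (cos (j%:R * h) - cos (K%:R * h)) * g j x = 0.
      have := g0 (x + h); have := g0 (x - h); have := g0 x => gx gxm gxp.
      transitivity (2^-1 * (\sum_(j < K.+1) g j (x + h) + \sum_(j < K.+1) g j (x - h))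
        - cos (K%:R * h) * \sum_(j < K.+1) g j x).
        rewrite -big_split /= !mulr_sumr -sumrB; apply: eq_bigr => j _.
        by rewrite gD; field.
      by rewrite gx gxm gxp; ring.
    by rewrite big_ord_recr /= subrr mul0r addr0.
  rewrite mulf_eq0 subr_eq0 => /orP[/eqP ck|/eqP //].
  have pi0 : 0 < pi :> R := pi_gt0 R.
  have hk : k'%:R * h < pi.
    by rewrite -Kh ltr_pM2r ?ltr_nat // /h divr_gt0 // ltr0n.
  have hk0 : 0 <= k'%:R * h by rewrite mulr_ge0 // divr_ge0 // ltW.
  have : cos pi < cos (k'%:R * h).
    by rewrite ltr_cos // in_itv /= ?lexx ?hk0 ?ltW.
  by rewrite ck Kh ltxx.
rewrite ltnS leq_eqVlt => /predU1P[->|/lowg //].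
by have := g0 theta; rewrite big_ord_recr /= big1 ?add0r // => i _; exact: lowg.
Qed.

Lemma Y_independent K (e : nat -> nat -> R) :
  (forall theta, \sum_(k < K) \sum_(i < (0 < k)%N.+1) e k i * Y k i theta = 0) ->
  forall k i, (k < K)%N -> (i < (0 < k)%N.+1)%N -> e k i = 0.
Proof.
move=> e0 k i kK ik.
have gk theta : \sum_(i < (0 < k)%N.+1) e k i * Y k i theta = 0.
  apply: (dalembert_independent
    (g := fun k theta => \sum_(i < (0 < k)%N.+1) e k i * Y k i theta)) e0 _ _ kK.
  move=> j x h; rewrite -big_split mulr_sumr /=; apply: eq_bigr => l _.
  rewrite -mulrDr mulrCA; congr (_ * _); rewrite /Y; case: eqP => [->|_].
    by rewrite mul0r cos0; ring.
  by case: eqP => _; rewrite mulrDr mulrBr ?cosDB ?sinDB.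
move: ik gk; rewrite lt0n; have [->|k0] := eqVneq k 0%N.
  rewrite /= ltnS leqn0 => /eqP -> /(_ 0); rewrite big_ord1 /Y eqxx => /eqP.
  by rewrite !mulf_eq0 invr_eq0 sqrtr_eq0 leNgt ltr0n pnatr_eq0 !orbF => /eqP.
move=> i2 gk; have gE x : e k 0 * cos (k%:R * x) + e k 1 * sin (k%:R * x) = 0.
  by have := gk x; rewrite !big_ord_recl big_ord0 /Y (negbTE k0) /= addr0.
(* The sine vanishes at [theta = 0], the cosine at [theta = pi / (2k)]. *)
have ek0 : e k 0 = 0 by have := gE 0; rewrite mulr0 cos0 sin0 mulr0 mulr1 addr0.
have ek1 : e k 1 = 0.
  have := gE (pi / 2 / k%:R); rewrite [k%:R * _]mulrC divfK ?pnatr_eq0 //.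
  by rewrite ek0 mul0r add0r sin_pihalf mulr1.
by move: i2; case: i => [|[|]].
Qed.

End TrigonometricIndependence.

Section CapIndependence.
Context {R : realType} (al : R).
Hypothesis al1 : -1 < al < 1.
Context (Rp : R -> R -> nat -> {poly R}).
Hypothesis hRp : forall a b : R, -1 < a -> 0 <= b ->
  orthonormal_polys al a b (Rp a b).

(* For fixed [phi] the Fourier modes in [theta] separate; within one mode, pairing with
   the orthonormal polynomials isolates each coefficient. *)
Lemma capf_independent (B : Defs.basis R) s b : -1 < b ->
  (forall n k i phi theta, cap_phi al phi ->
    B n k i phi theta = capf al s (Rp b (2 * k)%N%:R (n - k)%N) k i phi theta) ->
  independent al B.
Proof.
move=> b1 BE M d d0 n k i nM kn ik.
case: M d0 nM => [//|M] d0 nM.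
have kM : (k < M.+1)%N by lia.
pose q k i : {poly R} := \sum_(m < M.+1 | (k <= m)%N) d m k i *: Rp b (2 * k)%N%:R (m - k)%N.
have qE phi : cap_phi al phi -> (q k i).[cos phi] = 0.
  move=> hphi; have := cap_phi_sin hphi; have := cap_phi_cos hphi => ac sp.
  suff : (cos phi - al) `^ s * (q k i).[cos phi] * sin phi ^+ k = 0.
    move/eqP; rewrite !mulf_eq0 expf_eq0 (gt_eqF sp) andbF orbF.
    by rewrite gt_eqF ?powR_gt0 ?subr_gt0 //= => /eqP.
  apply: (Y_independent (K := M.+1)
    (e := fun k i => (cos phi - al) `^ s * (q k i).[cos phi] * sin phi ^+ k)) => //.
  move=> theta; rewrite -[RHS](d0 phi theta hphi) big_mkord.
  rewrite -(triangle_sum M (fun m k i => d m k i * B m k i phi theta)).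
  apply: eq_bigr => k' _; rewrite exchange_big /=; apply: eq_bigr => i' _.
  rewrite horner_sum mulr_sumr !mulr_suml; apply: eq_bigr => m _.
  by rewrite BE // /capf hornerZ; ring.
(* As [cos phi] sweeps []al, 1[], [q k i] vanishes there, hence so does its integral against any
   polynomial. *)
have : coef_fun al b k (q k i * Rp b (2 * k)%N%:R (n - k)%N) = 0.
  rewrite /coef_fun /wint.
  rewrite (@eq_Rintegral _ _ _ _ _ (fun=> 0)); first by rewrite Rintegral_cst // mul0r mulr0.
  move=> z; rewrite inE /= in_itv /= => /andP[az z1].
  have z11 : -1 <= z <= 1 by case/andP: al1 => *; lra.
  have [/andP[ac0 acpi] cacos] := acos_def z11.
  rewrite hornerM -cacos qE ?mul0r //; apply/and3P; split; last by rewrite cacos.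
    rewrite lt_neqAle ac0 andbT; apply/eqP => h0.
    by move: cacos z1; rewrite -h0 cos0 => ->; rewrite ltxx.
  rewrite lt_neqAle acpi andbT; apply/eqP => h0.
  by move: cacos az al1; rewrite h0 cospi => <- ? /andP[? _]; lra.
rewrite /q mulr_suml; under eq_bigr do rewrite -scalerAl.
rewrite (linear_form_sum (J := coef_fun al b k)); last first.
  by move=> c p r; rewrite (coef_fun_linear al1 hRp).
rewrite (bigD1 (Ordinal nM)) //= [X in _ + X]big1 ?addr0.
  by rewrite (coef_fun_orthonormal al1 hRp) // eqxx mulr1.
move=> m /andP[km]; rewrite -val_eqE /= => mn.
rewrite (coef_fun_orthonormal al1 hRp) // (_ : (m - k == n - k)%N = false) ?mulr0 //.
by apply/negbTE; move: mn; lia.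
Qed.

End CapIndependence.

(** * The operator matrices *)

Section BandedOperators.
Context {R : realType} (al : R).
Hypothesis al1 : -1 < al < 1.
Context (N : nat) (Rp : R -> R -> nat -> {poly R}).
Hypothesis hRp : forall a b : R, -1 < a -> 0 <= b ->
  orthonormal_polys al a b (Rp a b).
Local Notation sz := (\sum_(k < N.+1) block_size k)%N.
Local Notation P b k := (Rp b (2 * k)%N%:R).
Implicit Types (v : 'cV[R]_sz) (tgt src : Defs.basis R).

(** [Op] is expanded in the target polynomials. A degree step is at most two positions, hence the
    factors 2; in mode 0 it is only one. *)
Lemma degree_band_operator T src tgt s b l u (Op : nat -> nat -> {poly R}) :
  -1 < b ->
  (forall n k i phi theta, cap_phi al phi ->
    tgt n k i phi theta = capf al s (P b k (n - k)%N) k i phi theta) ->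
  (forall k n, degree_band al b k l u n (Op k n)) ->
  (forall v phi theta, cap_phi al phi -> T (expansion src v) phi theta =
    \sum_p v p 0 * capf al s (Op (mode p) (deg p - mode p)%N) (mode p) (par p) phi theta) ->
  exists A : 'M[R]_sz,
    unique (operator_matrix al T src tgt) A /\
    block_diagonal A /\ sub_block_bandwidths A (2 * l) (2 * u).
Proof.
move=> b1 tgtE bandOp TE; pose k p := nat_of_ord (mode (p : 'I_sz)).
pose n p := (deg (p : 'I_sz) - k p)%N.
have kd p : (k p <= deg (p : 'I_sz) <= N)%N := deg_bounds p.
have size_Op p : (size (Op (k p) (n p)) <= (n p).+1 + l)%N by have [] := bandOp (k p) (n p).
(* Source degrees are at most [N] and [Op] raises them by at most [l]. *)
apply: (@banded_operator _ _ _ _ _ _ _ _ (N + l).+1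
  (fun p m => coef_fun al b (k p) (Op (k p) (n p) * P b (k p) (m - k p)%N)) (@par N)).
- exact: (capf_independent al1 hRp b1 tgtE).
- by rewrite ltnS leq_addr.
- by move=> p; exact: par_bound.
- move=> v phi theta hphi; rewrite TE //; apply: eq_bigr => p _; congr (_ * _).
  rewrite -/(k p) -/(n p).
  rewrite -(big_nat_widenl (k p) 0 (N + l).+1 xpredT) //.
  rewrite -[X in \big[_/_]_(X <= _ < _) _]add0n big_addn big_mkord.
  have sOp : (size (Op (k p) (n p)) <= (N + l).+1 - k p)%N.
    by apply: leq_trans (size_Op p) _; have := kd p; rewrite /n; lia.
  rewrite {1}/capf {1}(coef_fun_expansion al1 hRp (k p) b1 sOp).
  rewrite horner_sum mulr_sumr !mulr_suml; apply: eq_bigr => m _.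
  by rewrite addnK tgtE // addnK /capf hornerZ; ring.
- move=> p m km mN t0.
  have un : (n p <= m - k p + u)%N.
    rewrite leqNgt; apply/negP => h; move/eqP: t0; apply.
    exact: (degree_band_coef hRp b1 (bandOp (k p) (n p)) h).
  have nl : (m - k p <= n p + l)%N.
    rewrite leqNgt; apply/negP => h; move/eqP: t0; apply.
    (* Here the roles swap: [Op] has too low a degree to pair with [P b k (m - k)]. *)
    rewrite /coef_fun mulrC (mulrC (Op _ _)) (wint_low_degree al1 hRp) ?mul0r //.
    by apply: leq_trans (size_Op p) _.
  rewrite -position_sig2 /in_band /position; have := kd p.
  by move: un nl km; rewrite /n /k; case: eqP => _; lia.
Qed.

Lemma expansion_Q a v phi theta : cap_phi al phi -> expansion (Q Rp a) v phi theta =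
  \sum_p v p 0 * capf al 0 (P a (mode p) (deg p - mode p)%N) (mode p) (par p) phi theta.
Proof.
by move=> hphi; rewrite expansionE; apply: eq_bigr => p _; rewrite (Q_capf _ _ _ _ _ _ hphi).
Qed.

Lemma wmul_expansion_Q s a v phi theta : cap_phi al phi ->
  wmul al s (expansion (Q Rp a) v) phi theta =
  \sum_p v p 0 * capf al s (P a (mode p) (deg p - mode p)%N) (mode p) (par p) phi theta.
Proof.
move=> hphi; rewrite /wmul expansion_Q // mulr_sumr; apply: eq_bigr => p _.
by rewrite /wR /capf !powRr0; ring.
Qed.

Lemma capf_shift1 s p k i phi theta : cap_phi al phi ->
  capf al (s - 1) (('X - al%:P) * p) k i phi theta = capf al s p k i phi theta.
Proof. by move=> hphi; rewrite -[_ - al%:P]expr1 (capf_shift _ _ _ _ _ _ hphi) subrK. Qed.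

Lemma Dphi_banded a : 0 <= a -> exists A : 'M[R]_sz,
  unique (operator_matrix al rho_partial_phi (Q Rp a) (Q Rp (a + 1))) A /\
  block_diagonal A /\ sub_block_bandwidths A 2 4.
Proof.
move=> a0; have a1 : -1 < a + 1 by lra.
apply: (degree_band_operator (l := 1) (u := 2) a1 _ (fun k n => dphi0_band al1 hRp k n a0)).
  by move=> *; exact: Q_capf.
move=> v phi theta hphi; rewrite (rho_partial_phi_capf (expansion_Q a v)) //.
by apply: eq_bigr => p _; rewrite dphi0 capf_shift1.
Qed.

Lemma Wphi_banded a : 0 < a -> exists A : 'M[R]_sz,
  unique (operator_matrix al (fun f => rho_partial_phi (wmul al a f))
    (Q Rp a) (weighted al (a - 1) (Q Rp (a - 1)))) A /\
  block_diagonal A /\ sub_block_bandwidths A 4 2.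
Proof.
move=> a0; have a1 : -1 < a - 1 by lra.
apply: (degree_band_operator (l := 2) (u := 1) a1 _ (fun k n => dphi_band al1 hRp k n a0)).
  by move=> *; exact: weighted_Q_capf.
by move=> v phi theta hphi; rewrite (rho_partial_phi_capf (wmul_expansion_Q a a v)).
Qed.

Lemma L_banded a ta : 0 <= a -> (2 <= ta)%N -> exists A : 'M[R]_sz,
  unique (operator_matrix al laplaceS (Q Rp a) (Q Rp (a + ta%:R))) A /\
  block_diagonal A /\ sub_block_bandwidths A 0 (2 * ta)%N.
Proof.
move=> a0 hta; have a1 : -1 < a + ta%:R by have := ler0n R ta; lra.
apply: (degree_band_operator (l := 0) a1 _ (fun k n => lap0_band al1 hRp k n a0 hta)).
  by move=> *; exact: Q_capf.
move=> v phi theta hphi; rewrite (laplaceS_capf _ (expansion_Q a v)) //; last exact: par_lt2.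
by apply: eq_bigr => p _; rewrite lap0 (capf_shift _ _ _ _ _ _ hphi) subrK.
Qed.

Lemma LW_banded a ta : (2 <= ta)%N -> 2 <= a -> -1 < a - ta%:R -> exists A : 'M[R]_sz,
  unique (operator_matrix al (fun f => laplaceS (wmul al a f))
    (Q Rp a) (weighted al (a - ta%:R) (Q Rp (a - ta%:R)))) A /\
  block_diagonal A /\ sub_block_bandwidths A (2 * ta)%N 0.
Proof.
move=> hta a2 a1.
apply: (degree_band_operator (u := 0) a1 _ (fun k n => lap_band al1 hRp k n a2 hta a1)).
  by move=> *; exact: weighted_Q_capf.
move=> v phi theta hphi.
rewrite (laplaceS_capf _ (wmul_expansion_Q a a v)) //; last exact: par_lt2.
apply: eq_bigr => p _; rewrite (capf_shift _ _ _ _ _ _ hphi).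
by congr (_ * capf _ _ _ _ _ _ _); rewrite natrB //; ring.
Qed.

Lemma DeltaW_banded : exists A : 'M[R]_sz,
  unique (operator_matrix al (fun f => laplaceS (wmul al 1 f)) (Q Rp 1) (Q Rp 1)) A /\
  block_diagonal A /\ sub_block_bandwidths A 2 2.
Proof.
have a1 : -1 < 1 :> R by lra.
apply: (degree_band_operator (l := 1) (u := 1) a1 _ (fun k n => lap1_band al1 hRp k n)).
  by move=> *; exact: Q_capf.
move=> v phi theta hphi.
rewrite (laplaceS_capf _ (wmul_expansion_Q 1 1 v)) //; last exact: par_lt2.
apply: eq_bigr => p _; rewrite lap1 (_ : 1 - 2 = 0 - 1 :> R) ?capf_shift1 //; ring.
Qed.

(** The degree is kept while cosine and sine, which are neighbours in the block, are exchanged. *)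
Lemma Dtheta_banded a : 0 <= a -> exists A : 'M[R]_sz,
  unique (operator_matrix al partial_theta (Q Rp a) (Q Rp a)) A /\
  block_diagonal A /\ sub_block_bandwidths A 1 1.
Proof.
move=> a0; have a1 : -1 < a by lra.
pose e (p : 'I_sz) : R := if par p == 0%N then - (mode p)%:R else (mode p)%:R.
(* Mode 0 has only the index 0, and its coefficient [e p] is 0. *)
apply: (@banded_operator _ _ _ _ _ _ _ _ N.+1
  (fun p m => if m == deg p then e p else 0)
  (fun p => if mode p == 0%N :> nat then 0%N else (par p == 0%N))).
- by apply: (capf_independent al1 hRp (s := 0) a1) => *; exact: Q_capf.
- by [].
- by move=> p; rewrite lt0n; case: eqP => // _; case: eqP.
- move=> v phi theta hphi; rewrite (partial_theta_capf (expansion_Q a v)) //.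
  apply: eq_bigr => p _; congr (_ * _); rewrite -/(e p).
  have /andP[md dN] := deg_bounds p.
  rewrite big_mkord (bigD1 (Ordinal (dN : deg p < N.+1)%N)) //= eqxx.
  rewrite [X in _ + X]big1 ?addr0; last first.
    by move=> m /andP[_]; rewrite -val_eqE /= => /negbTE ->; rewrite mul0r.
  rewrite (Q_capf _ _ _ _ _ _ hphi); case: (mode p =P 0%N :> nat) => [m0|//].
  by rewrite /e m0 oppr0 if_same !mul0r.
- move=> p m _ _; case: (m =P deg p) => [->|_]; last by rewrite eqxx.
  move=> _; rewrite -position_sig2 /in_band /position.
  have := par_bound p; rewrite lt0n.
  by case: (mode p =P 0%N :> nat) => _ /=; case: (par p =P 0%N) => /=; lia.
Qed.

End BandedOperators.

Theorem theorem1 (R : realType) (alpha : R) (halpha : -1 < alpha < 1) (N : nat)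
  (Rp : R -> R -> nat -> {poly R})
  (hRp : forall a b : R, -1 < a -> 0 <= b ->
     orthonormal_polys alpha a b (Rp a b))
  (a : R) (ha : 0 <= a) (ta : nat) (hta : (2 <= ta)%N) :
  (* D_phi^(a) *)
  (exists A : 'M[R]_(\sum_(k < N.+1) block_size k),
    unique (operator_matrix alpha rho_partial_phi
              (Q Rp a) (Q Rp (a + 1))) A /\
    block_diagonal A /\ sub_block_bandwidths A 2 4) /\
  (* W_phi^(a) *)
  (0 < a ->
   exists A : 'M[R]_(\sum_(k < N.+1) block_size k),
    unique (operator_matrix alpha
              (fun f => rho_partial_phi (wmul alpha a f))
              (Q Rp a) (weighted alpha (a - 1) (Q Rp (a - 1)))) A /\
    block_diagonal A /\ sub_block_bandwidths A 4 2) /\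
  (* D_theta *)
  (exists A : 'M[R]_(\sum_(k < N.+1) block_size k),
    unique (operator_matrix alpha partial_theta (Q Rp a) (Q Rp a)) A /\
    block_diagonal A /\ sub_block_bandwidths A 1 1) /\
  (* L^(a -> a + ta): (0, 4) for ta = 2 *)
  (exists A : 'M[R]_(\sum_(k < N.+1) block_size k),
    unique (operator_matrix alpha laplaceS
              (Q Rp a) (Q Rp (a + ta%:R))) A /\
    block_diagonal A /\ sub_block_bandwidths A 0 (2 * ta)%N) /\
  (* L_W^(a -> a - ta): (4, 0) for ta = 2 *)
  (2 <= a -> -1 < a - ta%:R ->
   exists A : 'M[R]_(\sum_(k < N.+1) block_size k),
    unique (operator_matrix alpha
              (fun f => laplaceS (wmul alpha a f))
              (Q Rp a) (weighted alpha (a - ta%:R) (Q Rp (a - ta%:R)))) A /\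
    block_diagonal A /\ sub_block_bandwidths A (2 * ta)%N 0) /\
  (* Delta_W^(1) *)
  (exists A : 'M[R]_(\sum_(k < N.+1) block_size k),
    unique (operator_matrix alpha
              (fun f => laplaceS (wmul alpha 1 f))
              (Q Rp 1) (Q Rp 1)) A /\
    block_diagonal A /\ sub_block_bandwidths A 2 2).
Proof.
split; first exact: Dphi_banded.
split; first by move=> a0; exact: Wphi_banded.
split; first exact: Dtheta_banded.
split; first exact: L_banded.
split; first by move=> a2 ata; exact: LW_banded.
exact: DeltaW_banded.
Qed.
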